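(* The parameterized cograph edge-completion problem admits a cubic vertex kernel. That is, there is a polynomial time algorithm which, given a finite simple undirected graph $G$ and an integer $k\geqslant 0$, outputs a graph $G'$ and an integer $k'\geqslant 0$ such that $(G,k)$ is a positive instance of the parameterized cograph edge-completion problem if and only if $(G',k')$ is, where $G'$ has $O(k^3)$ vertices and $k'$ is bounded by a computable function of $k$.
   Context: Graphs are finite, undirected, without loops or multiple edges. A cograph is a graph containing no induced path on four vertices ($P_4$); equivalently, a graph that can be constructed from single-vertex graphs by a sequence of disjoint unions and complete joins. Parameterized cograph edge-completion problem. Input: a graph $G=(V,E)$. Parameter: an integer $k\geqslant 0$. Question: is there a set $F$ of pairs of distinct vertices of $V$, disjoint from $E$, with $|F|\leqslant k$ such that $H=(V,E\cup F)$ is a cograph? A kernelization of a parameterized problem $Q$ is a polynomial time algorithm that transforms an instance $(x,k)$ into an instance $(x',k')$ such that $(x,k)\in Q\Leftrightarrow (x',k')\in Q$ and $|x'|,k'\leqslant h(k)$ for some computable function $h$. The output is called a kernel. A cubic vertex kernel for a graph problem is a kernel whose graph has $O(k^3)$ vertices. *)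

(* Defs.v *)
From mathcomp Require Import all_boot.

Set Implicit Arguments.
Unset Strict Implicit.
Unset Printing Implicit Defensive.

(** The model of computation is the random access machine in structured form
   (while programs).  A state consists of registers, whose indices are
   hard-wired in the program, and of a memory with indirect addressing; both
   hold natural numbers.  The arithmetic is limited to addition and truncated
   subtraction.  Without multiplication, the bit length of the stored numbers
   grows by at most a constant per step, so the unit-cost measure used here is
   polynomially related to Turing machine time (Cook and Reckhow 1973;
   Papadimitriou, Computational Complexity, Theorem 2.5). *)

Inductive expr : Type :=
| Const of nat
| Reg of nat
| Mem of expr
| Add of expr & expr
| Sub of expr & expr.

Inductive cmd : Type :=
| Skip
| Assign of nat & expr
| Store of expr & expr
| Seq of cmd & cmd
| If of expr & cmd & cmd
| While of expr & cmd.

Record state : Type := State { regs : nat -> nat; mem : nat -> nat }.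

Definition update (f : nat -> nat) (a v : nat) : nat -> nat :=
  fun b => if b == a then v else f b.

Fixpoint eval (s : state) (e : expr) : nat :=
  match e with
  | Const c => c
  | Reg r => regs s r
  | Mem a => mem s (eval s a)
  | Add e1 e2 => eval s e1 + eval s e2
  | Sub e1 e2 => eval s e1 - eval s e2
  end.

(** [exec p s t s']: started in state [s], the program [p] halts in state [s']
   after [t] steps.  A step is an elementary command or the evaluation of a
   guard; a guard holds when its value is nonzero. *)
Inductive exec : cmd -> state -> nat -> state -> Prop :=
| ExecSkip s :
    exec Skip s 1 s
| ExecAssign s r e :
    exec (Assign r e) s 1 (State (update (regs s) r (eval s e)) (mem s))
| ExecStore s a e :
    exec (Store a e) s 1 (State (regs s) (update (mem s) (eval s a) (eval s e)))
| ExecSeq p q s s1 s2 t1 t2 :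
    exec p s t1 s1 -> exec q s1 t2 s2 -> exec (Seq p q) s (t1 + t2) s2
| ExecIfTrue e p q s s1 t :
    eval s e != 0 -> exec p s t s1 -> exec (If e p q) s t.+1 s1
| ExecIfFalse e p q s s1 t :
    eval s e = 0 -> exec q s t s1 -> exec (If e p q) s t.+1 s1
| ExecWhileTrue e p s s1 s2 t1 t2 :
    eval s e != 0 -> exec p s t1 s1 -> exec (While e p) s1 t2 s2 ->
    exec (While e p) s (t1 + t2).+1 s2
| ExecWhileFalse e p s :
    eval s e = 0 -> exec (While e p) s 1 s.

Definition input (w : seq nat) : state := State (fun=> 0) (nth 0 w).

(** The memory may contain anything after the output word: the encodings used
   below are self-delimiting. *)
Definition output (s : state) (w : seq nat) : Prop :=
  forall i, i < size w -> mem s i = nth 0 w i.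

(** Total number of binary digits of the numbers in [w] (the number 0 has one
   digit); [trunc_log 2 0 = 0]. *)
Definition bitsize (w : seq nat) : nat := \sum_(x <- w) (trunc_log 2 x).+1.

Definition computable (h : nat -> nat) : Prop :=
  exists p : cmd, forall x : nat, exists (t : nat) (s : state),
    exec p (input [:: x]) t s /\ output s [:: h x].

Definition polytime (X Y : Type) (encX : X -> seq nat) (encY : Y -> seq nat)
    (f : X -> Y) : Prop :=
  exists (p : cmd) (c d : nat), forall x : X, exists (t : nat) (s : state),
    [/\ exec p (input (encX x)) t s,
        output s (encY (f x))
      & t <= c * bitsize (encX x) ^ d + c].

Definition enc_instance (X : Type) (enc : X -> seq nat) (xk : X * nat) :
  seq nat := xk.2 :: enc xk.1.

Definition kernelization (X : Type) (enc : X -> seq nat) (Q : X -> nat -> Prop)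
    (K : X * nat -> X * nat) : Prop :=
  [/\ polytime (enc_instance enc) (enc_instance enc) K,
      forall (x : X) (k : nat), Q x k <-> Q (K (x, k)).1 (K (x, k)).2
    & exists2 h : nat -> nat, computable h &
        forall (x : X) (k : nat),
          bitsize (enc (K (x, k)).1) <= h k /\ (K (x, k)).2 <= h k].

Record graph : Type := Graph {
  nvert : nat;
  edges : {set {set 'I_nvert}};
  edgesP : forall e, e \in edges -> #|e| = 2
}.

Definition adj (T : finType) (E : {set {set T}}) (x y : T) : bool :=
  [set x; y] \in E.

Definition P4 (i j : 'I_4) : bool := (i.+1 == j) || (j.+1 == i).

Definition cograph (T : finType) (E : {set {set T}}) : Prop :=
  ~ exists f : 'I_4 -> T,
      injective f /\ forall i j : 'I_4, adj E (f i) (f j) = P4 i j.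

Definition cograph_completion (G : graph) (k : nat) : Prop :=
  exists F : {set {set 'I_(nvert G)}},
    [/\ forall e, e \in F -> #|e| = 2,
        [disjoint F & edges G],
        #|F| <= k
      & cograph (edges G :|: F)].

(** The number of vertices followed by the adjacency matrix, row by row. *)
Definition enc_graph (G : graph) : seq nat :=
  nvert G :: [seq nat_of_bool (adj (edges G) i j)
             | i <- enum 'I_(nvert G), j <- enum 'I_(nvert G)].

(** The bound O(k^3) cannot hold in the form [C * k ^ 3] at [k = 0], where a
   negative instance has at least four vertices; small [k] are covered by the
   function [h] of [kernelization]. *)
Definition cubic_vertex_kernel (Q : graph -> nat -> Prop)
    (K : graph * nat -> graph * nat) : Prop :=
  kernelization enc_graph Q K /\
  exists C k0 : nat, forall (G : graph) (k : nat),
    k0 <= k -> nvert (K (G, k)).1 <= C * k ^ 3.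

(* Main.v *)
Require Import Defs.
From mathcomp Require Import all_boot zify.

Set Implicit Arguments.
Unset Strict Implicit.
Unset Printing Implicit Defensive.

(** Three reduction rules are applied while [k < n].  If [v] lies in a cograph
   module with at least [k + 2] vertices, or in a module [M] of that size that
   is the join or the disjoint union of a cograph [C] containing [v] and of
   [M :\: C], then [v] is deleted: a completion of [G - v] leaves the edges
   between some [w] of [M] and the outside of [M] unchanged, and the module can
   be substituted for [w].  If [x s y p] is an induced path for a fixed [s] and
   more than [k] vertices [p], then the edge [xy] is forced, since every [p]
   would otherwise require its own edge [xp] or [sp].

   Let [H] be a completion of a reduced graph with at most [k] added edges, which
   touch at most [2k] affected vertices.  Let [W] be a module of [H] and [X] a
   minimal module inside [W] with the same affected vertices.  The vertices of
   [W] outside [X] are joined or not joined to [X]; the two families have nested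
   neighbourhoods in each other, and vertices of one family with the same
   neighbours in the other one form a module of [G], which has at most [k + 1]
   vertices.  If some added edge leaves [W] from [X], the forced edge rule bounds
   the number of these classes; otherwise [W] is a module of [G] and the rule on
   [C] applies.  So [W] has O(k^2) vertices outside [X], while [X] is an affected
   vertex or splits into two modules with fewer affected vertices.  Induction
   gives O(k) * O(k^2) vertices.

   The rules are first-order formulas with counting over the adjacency matrix, so
   each of them is evaluated by nested loops over the vertices. *)

(** * Programs for functions defined by bounded sums *)

(** The threshold [k + 2] comes from the pigeonhole principle: once [v] is deleted the module keeps
    [k + 1] vertices, and each of them would otherwise have its own added edge leaving the module.
    The obstacle in bounding a reduced graph is that [X] hides affected vertices, so a large module
    [W] need not be cographic and deletion from cographic modules alone says nothing about it. Hence
    the rule with [C]: the nested neighbourhoods have an extreme end that is joined to, or separated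
    from, all the rest of [W], and only a part of that end has to be cographic. The recursion into
    two modules is a binary tree with at most [2k] leaves, one per affected vertex, hence with fewer
    than [4k] nodes. The guard [k < n] serves the running time: each effective round decreases
    [n + k], but [k] alone may be exponential in the input length; when [n <= k] the instance is
    already small. A reduced graph that is still too large has no completion and is replaced by a
    fixed negative instance. *)

Lemma updateE f a v b : update f a v b = if b == a then v else f b.
Proof. by []. Qed.

(** The guard has to count down from [N], which fixes the number of rounds in advance. [B.+1] pays
    for the body and its guard, the last successor for the failing guard. *)
Lemma while_loop (e : expr) (body : cmd) (Inv : nat -> state -> Prop) (N B : nat) :
  (forall i s, Inv i s -> eval s e = N - i) ->
  (forall i s, i < N -> Inv i s ->
     exists t s', [/\ exec body s t s', Inv i.+1 s' & t <= B]) ->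
  forall s, Inv 0 s ->
  exists t s', [/\ exec (While e body) s t s', Inv N s' & t <= (N * B.+1).+1].
Proof.
move=> guardE step s I0.
suff H j i s0 : i + j = N -> Inv i s0 ->
    exists t s', [/\ exec (While e body) s0 t s', Inv N s' & t <= (j * B.+1).+1].
  exact: (H N 0).
elim: j i s0 => [|j IH] i s0 iN Ii.
  rewrite addn0 in iN; subst i; exists 1, s0; split=> //.
  by apply: ExecWhileFalse; rewrite (guardE _ _ Ii) subnn.
have ltiN : i < N by lia.
have [t [s1 [ex1 I1 le1]]] := step _ _ ltiN Ii.
have [|t' [s2 [ex2 I2 le2]]] := IH i.+1 s1 _ I1; first by lia.
exists (t + t').+1, s2; split=> //; last by rewrite mulSn; lia.
by apply: ExecWhileTrue ex1 ex2; rewrite (guardE _ _ Ii); lia.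
Qed.

(** Running times are kept as pure powers of [L.+2]: the base is at least 2, so one extra factor
    absorbs a sum, and at least [L], so a loop costs a fixed increase of the exponent. Only
    exponents have to be tracked. *)
Lemma leq_powD L a b i j : a <= L.+2 ^ i -> b <= L.+2 ^ j ->
  a + b <= L.+2 ^ (i + j).+1.
Proof.
move=> ha hb; rewrite expnS.
have hi : L.+2 ^ i <= L.+2 ^ (i + j) by rewrite leq_exp2l // leq_addr.
have hj : L.+2 ^ j <= L.+2 ^ (i + j) by rewrite leq_exp2l // leq_addl.
by apply: (@leq_trans (2 * L.+2 ^ (i + j))); [lia | rewrite leq_mul2r orbT].
Qed.

Lemma leq_powc L c : c <= L.+2 ^ c.
Proof. exact: ltnW (ltn_expl c _). Qed.

Lemma leq_powM L b j : b <= L.+2 ^ j -> L * b <= L.+2 ^ j.+1.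
Proof. by move=> hb; rewrite expnS; apply: leq_mul => //; lia. Qed.

Lemma leq_pow_loop L b j : b <= L.+2 ^ j -> (L * b.+1).+1 <= L.+2 ^ (j + 5).
Proof.
move=> hb; have := leq_powM (leq_powD hb (leq_powc L 1)).
rewrite addn1 => h; have := leq_powD h (leq_powc L 1).
by rewrite addn1 => /leq_trans; apply; rewrite leq_exp2l //; lia.
Qed.

(* The memory below [L] holds the table [m]; the cells above [L] are scratch
   space, and [m] is required to vanish there so that reading it needs no
   side condition. *)
Definition rep (L : nat) (m : nat -> nat) (s : state) : Prop :=
  [/\ regs s 0 = L, forall a, a < L -> Defs.mem s a = m a
    & forall a, L <= a -> m a = 0].

Definition tabfun := nat -> (nat -> nat) -> seq nat -> nat.

(** The list [g] tells in which registers the variables live, and [d] is the first free register: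
    compiling a subterm at a larger [d] protects the values already computed. Register 0 holds [L],
    whence [0 < d]. The exponent [D] is chosen before [L], [m] and [s], which makes the time bound
    uniform. *)
Definition realizable (f : tabfun) : Prop :=
  forall (g : seq nat) (d : nat), 0 < d -> all (fun r => r < d) g ->
  exists (p : cmd) (D : nat), forall L m s, rep L m s ->
  exists t s', [/\ exec p s t s', Defs.mem s' = Defs.mem s,
      forall r, r < d -> regs s' r = regs s r,
      regs s' d = f L m [seq regs s r | r <- g]
    & t <= L.+2 ^ D].

Lemma rep_eqmem L m s s' : regs s' 0 = regs s 0 -> Defs.mem s' = Defs.mem s ->
  rep L m s -> rep L m s'.
Proof. by move=> h1 h2 [r1 r2 r3]; split; rewrite ?h1 ?h2. Qed.

Lemma map_regs g d s s' : all (fun r => r < d) g ->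
  (forall r, r < d -> regs s' r = regs s r) ->
  [seq regs s' r | r <- g] = [seq regs s r | r <- g].
Proof. by move=> /allP gd h; apply/eq_in_map => r /gd /h. Qed.

Lemma realizable_ext f f' : (forall L m v, f L m v = f' L m v) ->
  realizable f -> realizable f'.
Proof.
move=> h rf g d d0 gd; have [p [D H]] := rf g d d0 gd; exists p, D => L m s /H.
by case=> t [s' [? ? ? h4 ?]]; exists t, s'; split=> //; rewrite h4 h.
Qed.

Lemma realizable_const c : realizable (fun _ _ _ => c).
Proof.
move=> g d d0 gd; exists (Assign d (Const c)), 1 => L m s _.
exists 1, (State (update (regs s) d c) (Defs.mem s)); split=> //.
- exact: ExecAssign.
- by move=> r rd /=; rewrite updateE ltn_eqF.
- by rewrite /= updateE eqxx.
Qed.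

Lemma realizable_var i : realizable (fun _ _ v => nth 0 v i).
Proof.
move=> g d d0 gd.
exists (Assign d (if i < size g then Reg (nth 0 g i) else Const 0)), 1 => L m s _.
exists 1; eexists; split; first exact: ExecAssign.
- by [].
- by move=> r rd /=; rewrite updateE ltn_eqF.
- rewrite /= updateE eqxx; case: ltnP => hi /=; first by rewrite (nth_map 0).
  by rewrite nth_default // size_map.
- by [].
Qed.

Lemma realizable_read f : realizable f ->
  realizable (fun L m v => m (f L m v)).
Proof.
move=> rf g d d0 gd; have [p [D H]] := rf g d d0 gd.
(* The comparison with [L] is there because cells from [L] on may contain scratch values, while [m]
   vanishes there. *)
exists (Seq p (If (Defs.Sub (Reg 0) (Reg d)) (Assign d (Defs.Mem (Reg d))) (Assign d
  (Const 0)))).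
exists (D + 2).+1 => L m s R.
have [t [s1 [e1 m1 r1 v1 t1]]] := H _ _ _ R.
have [R1 R2 R3] := R.
exists (t + 2), (State (update (regs s1) d (m (regs s1 d))) (Defs.mem s1)); split=> //.
- apply: ExecSeq e1 _; case: (ltnP (regs s1 d) L) => hd.
    rewrite -R2 // -m1.
    by apply: ExecIfTrue; [rewrite /= r1 // R1 subn_eq0 -ltnNge | apply: ExecAssign].
  rewrite R3 //.
  by apply: ExecIfFalse; [apply/eqP; rewrite /= r1 // R1 subn_eq0 | apply: ExecAssign].
- by move=> r rd /=; rewrite updateE ltn_eqF // r1.
- by rewrite /= updateE eqxx v1.
- exact: leq_powD t1 (leq_powc _ 2).
Qed.

Lemma realizable_op2 (E : expr -> expr -> expr) (op : nat -> nat -> nat) f1 f2 :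
  (forall s x y, eval s (E x y) = op (eval s x) (eval s y)) ->
  realizable f1 -> realizable f2 ->
  realizable (fun L m v => op (f1 L m v) (f2 L m v)).
Proof.
move=> EE rf1 rf2 g d d0 gd.
have [p1 [D1 H1]] := rf1 g d d0 gd.
have gd' : all (fun r => r < d.+1) g by apply: sub_all gd => r; apply: ltnW.
have [p2 [D2 H2]] := rf2 g d.+1 isT gd'.
exists (Seq p1 (Seq p2 (Assign d (E (Reg d) (Reg d.+1))))), (D1 + (D2 + 1).+1).+1.
move=> L m s R; have [t1 [s1 [e1 m1 r1 v1 le1]]] := H1 _ _ _ R.
have [|t2 [s2 [e2 m2 r2 v2 le2]]] := H2 L m s1; first by apply: rep_eqmem R; rewrite ?r1.
exists (t1 + (t2 + 1)); eexists; split.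
- by apply: ExecSeq e1 _; apply: ExecSeq e2 _; apply: ExecAssign.
- by rewrite /= m2.
- by move=> r rd; rewrite /= updateE ltn_eqF // r2 ?r1 // ltnW.
- by rewrite /= updateE eqxx EE /= v2 r2 // v1 (map_regs gd r1).
- by apply: leq_powD le1 _; apply: leq_powD le2 _; apply: leq_powc.
Qed.

Lemma realizable_add f1 f2 : realizable f1 -> realizable f2 ->
  realizable (fun L m v => f1 L m v + f2 L m v).
Proof. exact: (@realizable_op2 Add addn). Qed.

Lemma realizable_sub f1 f2 : realizable f1 -> realizable f2 ->
  realizable (fun L m v => f1 L m v - f2 L m v).
Proof. exact: (@realizable_op2 Defs.Sub subn). Qed.

Lemma realizable_if (b : nat -> (nat -> nat) -> seq nat -> bool) f1 f2 :
  realizable (fun L m v => b L m v) -> realizable f1 -> realizable f2 ->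
  realizable (fun L m v => if b L m v then f1 L m v else f2 L m v).
Proof.
move=> rb rf1 rf2 g d d0 gd.
have [p0 [D0 H0]] := rb g d d0 gd.
have [p1 [D1 H1]] := rf1 g d d0 gd.
have [p2 [D2 H2]] := rf2 g d d0 gd.
exists (Seq p0 (If (Reg d) p1 p2)), (D0 + (D1 + (1 + D2).+1).+1).+1 => L m s R.
have [t0 [s0 [e0 m0 r0 v0 le0]]] := H0 _ _ _ R.
have R0 : rep L m s0 by apply: rep_eqmem R; rewrite ?r0.
case bE: (b L m [seq regs s r | r <- g]) v0 => v0.
- have [t1 [s1 [e1 m1 r1 v1 le1]]] := H1 _ _ _ R0.
  exists (t0 + t1.+1), s1; split.
  + by apply: ExecSeq e0 _; apply: ExecIfTrue; rewrite //= v0.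
  + by rewrite m1.
  + by move=> r rd; rewrite r1 ?r0.
  + by rewrite v1 (map_regs gd r0).
  + apply: leq_powD le0 _; rewrite -addn1; apply: leq_powD le1 _.
    by have := leq_powD (leq_powc L 1) (leq0n (L.+2 ^ D2)); rewrite addn0.
- have [t2 [s2 [e2 m2 r2 v2 le2]]] := H2 _ _ _ R0.
  exists (t0 + t2.+1), s2; split.
  + by apply: ExecSeq e0 _; apply: ExecIfFalse; rewrite //= v0.
  + by rewrite m2.
  + by move=> r rd; rewrite r2 ?r0.
  + by rewrite v2 (map_regs gd r0).
  + apply: leq_powD le0 _; rewrite -[t2.+1]add0n; apply: leq_powD (leq0n _) _.
    by rewrite -add1n; apply: leq_powD (leq_powc L 1) le2.
Qed.

(** The index is pushed onto the front of the environment, in the manner of de Bruijn: in the body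
    [nth 0 v 0] is the index and [behead v] the outer environment. Registers [d], [d.+1] and [d.+2]
    hold the partial sum, the index and the value of the body. *)
Lemma realizable_sum (f : nat -> (nat -> nat) -> nat -> seq nat -> nat) :
  realizable (fun L m v => f L m (nth 0 v 0) (behead v)) ->
  realizable (fun L m v => \sum_(i < L) f L m i v).
Proof.
move=> rf g d d0 gd.
have gd' : all (fun r => r < d.+2) (d.+1 :: g).
  by rewrite /= ltnSn; apply: sub_all gd => r; lia.
have [p [D H]] := rf (d.+1 :: g) d.+2 isT gd'.
pose body := Seq p (Seq (Assign d (Add (Reg d) (Reg d.+2)))
                        (Assign d.+1 (Add (Reg d.+1) (Const 1)))).
exists (Seq (Assign d (Const 0)) (Seq (Assign d.+1 (Const 0))
  (While (Defs.Sub (Reg 0) (Reg d.+1)) body))), (2 + ((D + 2).+1 + 5)).+1.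
move=> L m s R.
pose v := [seq regs s r | r <- g].
pose Inv i s' := [/\ rep L m s', Defs.mem s' = Defs.mem s, forall r, r < d -> regs s' r =
  regs s r,
  regs s' d.+1 = i & regs s' d = \sum_(j < i) f L m j v].
pose s0 := State (update (update (regs s) d 0) d.+1 0) (Defs.mem s).
have [| | |t [s1 [e1 [I1 I2 I3 I4 I5] le1]]] :=
    @while_loop (Defs.Sub (Reg 0) (Reg d.+1)) body Inv L (L.+2 ^ (D + 2).+1) _ _ s0.
- by move=> i s' [[r0 _ _] _ _ h _] /=; rewrite h r0.
- move=> i s' iL [R' m' r' c' v'].
  have [t1 [s1 [e1 m1 r1 v1 le1]]] := H _ _ _ R'.
  exists (t1 + 2); eexists; split.
  + apply: ExecSeq e1 _; apply: (@ExecSeq _ _ _ _ _ 1 1); exact: ExecAssign.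
  + split.
    * apply: rep_eqmem R'; last by rewrite /= m1.
      by rewrite /= !updateE; case: (d) d0 => // d' _ /=; rewrite r1.
    * by rewrite /= m1.
    * move=> r rd; rewrite /= !updateE !ltn_eqF ?r1 ?r' //; lia.
    * by rewrite /= updateE eqxx updateE gtn_eqF // r1 // c' addn1.
    * rewrite /= updateE ltn_eqF // updateE eqxx /= r1; last by lia.
      rewrite v' v1 /= c' big_ord_recr /=; congr (_ + f L m i _).
      by apply/eq_in_map => r /(allP gd); apply: r'.
  + exact: leq_powD le1 (leq_powc _ 2).
- split=> //.
  + apply: rep_eqmem R => //=; rewrite !updateE.
    by case: (d) d0.
  + by move=> r rd; rewrite /= !updateE !ltn_eqF //; lia.
  + by rewrite /= updateE eqxx.
  + by rewrite /= updateE ltn_eqF // updateE eqxx big_ord0.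
exists (2 + t), s1; split=> //.
- apply: (@ExecSeq _ _ _ _ _ 1 (1 + t)); first exact: ExecAssign.
  by apply: (@ExecSeq _ _ _ _ _ 1 t); first exact: ExecAssign.
- apply: leq_powD (leq_powc _ 2) _.
  by apply: leq_trans le1 _; apply: leq_pow_loop.
Qed.

Definition transformer (F : nat -> (nat -> nat) -> nat -> nat) : Prop :=
  forall d : nat, 0 < d ->
  exists (p : cmd) (D : nat), forall L m s, rep L m s ->
  exists t s', [/\ exec p s t s', rep L (F L m) s',
      forall r, r < d -> regs s' r = regs s r & t <= L.+2 ^ D].

Lemma transformer_comp F1 F2 : transformer F1 -> transformer F2 ->
  transformer (fun L m => F2 L (F1 L m)).
Proof.
move=> tf1 tf2 d d0; have [p1 [D1 H1]] := tf1 d d0; have [p2 [D2 H2]] := tf2 d d0.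
exists (Seq p1 p2), (D1 + D2).+1 => L m s /H1[t1 [s1 [e1 R1 r1 le1]]].
have [t2 [s2 [e2 R2 r2 le2]]] := H2 _ _ _ R1.
exists (t1 + t2), s2; split=> //; first exact: ExecSeq e1 e2.
- by move=> r rd; rewrite r2 ?r1.
- exact: leq_powD.
Qed.

Lemma transformer_iter F : transformer F ->
  transformer (fun L m => iter L (F L) m).
Proof.
move=> tf d d0; have [p [D H]] := tf d.+1 isT.
pose body := Seq p (Assign d (Add (Reg d) (Const 1))).
exists (Seq (Assign d (Const 0)) (While (Defs.Sub (Reg 0) (Reg d)) body)).
exists (1 + ((D + 1).+1 + 5)).+1 => L m s R.
pose Inv i s' := [/\ rep L (iter i (F L) m) s',
  forall r, r < d -> regs s' r = regs s r & regs s' d = i].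
have [| | |t [s1 [e1 [I1 I2 I3] le1]]] := @while_loop (Defs.Sub (Reg 0) (Reg d)) body Inv
    L (L.+2 ^ (D + 1).+1) _ _ (State (update (regs s) d 0) (Defs.mem s)).
- by move=> i s' [[r0 _ _] _ h] /=; rewrite h r0.
- move=> i s' iL [R' r' c'].
  have [t1 [s1 [e1 R1 r1 le1]]] := H _ _ _ R'.
  exists (t1 + 1); eexists; split.
  + by apply: ExecSeq e1 _; apply: ExecAssign.
  + split.
    * by apply: rep_eqmem R1 => //=; rewrite updateE ltn_eqF.
    * by move=> r rd; rewrite /= updateE ltn_eqF // r1 ?r' // ltnW.
    * by rewrite /= updateE eqxx r1 // c' addn1.
  + exact: leq_powD le1 (leq_powc _ 1).
- split=> //=; first by apply: rep_eqmem R => //=; rewrite updateE ltn_eqF.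
  + by move=> r rd; rewrite updateE ltn_eqF.
  + by rewrite updateE eqxx.
exists (1 + t), s1; split=> //.
- by apply: (@ExecSeq _ _ _ _ _ 1 t); first exact: ExecAssign.
- by apply: leq_powD (leq_powc _ 1) _; apply: leq_trans le1 _; apply: leq_pow_loop.
Qed.

(* The new table is built in the cells [L .. 2L-1] and then copied down, since
   [f] may read any entry of the old one. *)
Lemma transformer_update f : realizable f ->
  transformer (fun L m a => if a < L then f L m [:: a] else 0).
Proof.
move=> rf d d0.
have gd : all (fun r => r < d.+1) [:: d] by rewrite /= ltnSn.
have [p [D H]] := rf [:: d] d.+1 isT gd.
pose incr := Assign d (Add (Reg d) (Const 1)).
pose guard := Defs.Sub (Reg 0) (Reg d).
pose body1 := Seq p (Seq (Store (Add (Reg 0) (Reg d)) (Reg d.+1)) incr).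
pose body2 := Seq (Store (Reg d) (Defs.Mem (Add (Reg 0) (Reg d)))) incr.
exists (Seq (Assign d (Const 0)) (Seq (While guard body1)
       (Seq (Assign d (Const 0)) (While guard body2)))).
exists (1 + (((D + 2).+1 + 5) + (1 + (2 + 5)).+1).+1).+1 => L m s R.
pose F a := if a < L then f L m [:: a] else 0.
pose Inv1 i s' := [/\ rep L m s', forall r, r < d -> regs s' r = regs s r, regs s' d = i
  & forall a, a < i -> Defs.mem s' (L + a) = F a].
pose Inv2 i s' := [/\ forall r, r < d -> regs s' r = regs s r, regs s' d = i,
  forall a, a < L -> Defs.mem s' (L + a) = F a & forall a, a < i -> Defs.mem s' a = F a].
have R0 : regs s 0 = L by case: R.
have [| | |t1 [s1 [e1 I1 le1]]] := @while_loop guard body1 Inv1 L (L.+2 ^ (D + 2).+1)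
    _ _ (State (update (regs s) d 0) (Defs.mem s)).
- by move=> i s' [[r0 _ _] _ h _] /=; rewrite h r0.
- move=> i s' iL [R' r' c' v'].
  have [t1 [s1 [e1 m1 r1 v1 le1]]] := H _ _ _ R'.
  exists (t1 + 2); eexists; split.
  + by apply: ExecSeq e1 _; apply: (@ExecSeq _ _ _ _ _ 1 1);
    [apply: ExecStore | apply: ExecAssign].
  + case: R' => [q1 q2 q3].
    have s10 : regs s1 0 = L by rewrite r1.
    have s1d : regs s1 d = i by rewrite r1.
    split=> /=.
    * split=> //=; first by rewrite updateE ltn_eqF.
      by move=> a aL; rewrite updateE m1 q2 // ltn_eqF // s10; lia.
    * by move=> r rd; rewrite updateE ltn_eqF // r1 ?r' // ltnW.
    * by rewrite updateE eqxx s1d addn1.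
    * move=> a; rewrite ltnS leq_eqVlt updateE s10 s1d eqn_add2l.
      by case: eqP => [-> _|_ /= /v' <-]; rewrite ?v1 /= ?c' /F ?iL // m1.
  + exact: leq_powD le1 (leq_powc _ 2).
- split=> //=; first by apply: rep_eqmem R => //=; rewrite updateE ltn_eqF.
  + by move=> r rd; rewrite updateE ltn_eqF.
  + by rewrite updateE eqxx.
have [R1 r1 c1 v1] := I1.
have [| | |t2 [s2 [e2 [J1 J2 J3 J4] le2]]] := @while_loop guard body2 Inv2 L 2
    _ _ (State (update (regs s1) d 0) (Defs.mem s1)).
- by move=> i s' [r' h _ _] /=; rewrite h r' // R0.
- move=> i s' iL [r' c' u' v'].
  exists 2; eexists; split.
  + by apply: (@ExecSeq _ _ _ _ _ 1 1); [apply: ExecStore | apply: ExecAssign].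
  + split=> /=.
    * by move=> r rd; rewrite updateE ltn_eqF // r'.
    * by rewrite updateE eqxx c' addn1.
    * by move=> a aL; rewrite updateE c' gtn_eqF ?u' //; lia.
    * move=> a; rewrite ltnS leq_eqVlt updateE c'.
      by case: eqP => [-> _|_ /= /v' <-] //; rewrite r' // R0 u'.
  + by [].
- split=> //=.
  + by move=> r rd; rewrite updateE ltn_eqF // r1.
  + by rewrite updateE eqxx.
exists (1 + (t1 + (1 + t2))), s2; split=> //.
- apply: (@ExecSeq _ _ _ _ _ 1); first exact: ExecAssign.
  apply: ExecSeq e1 _; apply: (@ExecSeq _ _ _ _ _ 1); first exact: ExecAssign.
  exact: e2.
- split=> [|a aL|a aL]; first by rewrite J1.
    by rewrite J4.
  by rewrite ltnNge aL.
- apply: leq_powD (leq_powc _ 1) _; apply: leq_powD.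
    by apply: leq_trans le1 _; apply: leq_pow_loop.
  apply: leq_powD (leq_powc _ 1) _; apply: leq_trans le2 _.
  by apply: leq_pow_loop; apply: leq_powc.
Qed.

(** * Reduction rules *)

(** Distinctness of the four vertices follows from these six conditions when the relation is
    symmetric and irreflexive. *)
Definition p4 (T : Type) (e : rel T) (a b c d : T) : bool :=
  [&& e a b, e b c, e c d, ~~ e a c, ~~ e b d & ~~ e a d].

Definition compl (T : eqType) (e : rel T) : rel T :=
  fun x y => (x != y) && ~~ e x y.

Section Rules.

Variables (T : eqType) (s : seq T) (e : rel T).
Implicit Types (M : pred T) (u v w x y z : T) (k : nat).

(** Vertices are drawn from a sequence [s] so that the same formulas can be read over [enum T] in
    the correctness proof and over natural numbers in the program. *)
Definition split1 u v x := [|| x == u, x == v | e x u != e x v].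

(* Two rounds of adding splitters already close [{u, v}] to a module in the
   situations where a reduction rule is needed; this keeps the rules free of
   fixpoints. *)
Definition split2 u v x :=
  split1 u v x || has (fun y => split1 u v y && (e x y != e x u)) s.

Definition moduleb M :=
  ~~ has (fun x => has (fun y => has (fun z =>
       [&& M x, M y, ~~ M z & e z x != e z y]) s) s) s.

Definition cographb M :=
  ~~ has (fun a => has (fun b => has (fun c => has (fun d =>
       [&& M a, M b, M c, M d & p4 e a b c d]) s) s) s) s.

Definition twin v u := moduleb (split2 u v) && cographb (split2 u v).

Definition twin_rule k v := k.+1 < count (twin v) s.

(** Intended as the component of [v] in the complement of the graph induced on [split2 u v]. Two
    steps suffice because the components of a cograph have diameter at most two; taking [z] to be
    [v] or [w] covers shorter paths. [complete_core] verifies that nothing was missed. *)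
Definition core u v w :=
  split2 u v w && has (fun z => [&& split2 u v z, ~~ e z v & ~~ e z w]) s.

Definition complete_core u v :=
  ~~ has (fun w => has (fun w' =>
       [&& core u v w, split2 u v w', ~~ core u v w' & ~~ e w w']) s) s.

Definition chain_rule k v :=
  has (fun u => [&& moduleb (split2 u v), k.+1 < count (split2 u v) s,
                    cographb (core u v) & complete_core u v]) s.

Definition edge_rule k x y :=
  has (fun z => k < count (fun p => p4 e x z y p) s) s.

End Rules.

(** Complementation preserves modules and cographs, so the twin rule is its own complement; it
    exchanges joins and disjoint unions, hence the second use of [chain_rule]. *)
Definition vertex_rule (T : eqType) (s : seq T) (e : rel T) k v :=
  [|| twin_rule s e k v, chain_rule s e k v | chain_rule s (compl e) k v].

(** * Invariance of the rules under injective relabelling *)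

Section RulesMap.

Variables (T T' : eqType) (f : T -> T') (s : seq T) (e : rel T) (e' : rel T').
Hypotheses (f_inj : injective f) (ee' : forall x y, e' (f x) (f y) = e x y).

Lemma split1_map u v x : split1 e' (f u) (f v) (f x) = split1 e u v x.
Proof. by rewrite /split1 !(inj_eq f_inj) !ee'. Qed.

Lemma split2_map u v x : split2 (map f s) e' (f u) (f v) (f x) = split2 s e u v x.
Proof.
rewrite /split2 has_map split1_map; congr (_ || _).
by apply: eq_has => y /=; rewrite split1_map !ee'.
Qed.

Lemma moduleb_map (M : pred T) (M' : pred T') : (forall x, M' (f x) = M x) ->
  moduleb (map f s) e' M' = moduleb s e M.
Proof.
move=> MM; rewrite /moduleb has_map; congr (~~ _).
apply: eq_has => x /=; rewrite has_map; apply: eq_has => y /=.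
by rewrite has_map; apply: eq_has => z /=; rewrite !MM !ee'.
Qed.

Lemma cographb_map (M : pred T) (M' : pred T') : (forall x, M' (f x) = M x) ->
  cographb (map f s) e' M' = cographb s e M.
Proof.
move=> MM; rewrite /cographb has_map; congr (~~ _).
apply: eq_has => a /=; rewrite has_map; apply: eq_has => b /=.
rewrite has_map; apply: eq_has => c /=; rewrite has_map.
by apply: eq_has => d /=; rewrite /p4 !MM !ee'.
Qed.

Lemma twin_rule_map k v : twin_rule (map f s) e' k (f v) = twin_rule s e k v.
Proof.
rewrite /twin_rule count_map; congr (_ < _); apply: eq_count => u.
by congr (_ && _); [apply: moduleb_map | apply: cographb_map] => x; apply: split2_map.
Qed.

Lemma core_map u v w : core (map f s) e' (f u) (f v) (f w) = core s e u v w.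
Proof.
rewrite /core split2_map has_map; congr (_ && _).
by apply: eq_has => z /=; rewrite split2_map !ee'.
Qed.

Lemma chain_rule_map k v : chain_rule (map f s) e' k (f v) = chain_rule s e k v.
Proof.
rewrite /chain_rule has_map; apply: eq_has => u /=; congr [&& _, _, _ & _].
- by apply: moduleb_map => x; apply: split2_map.
- by rewrite count_map; congr (_ < _); apply: eq_count => x; apply: split2_map.
- by apply: cographb_map => x; apply: core_map.
- rewrite /complete_core has_map; congr (~~ _); apply: eq_has => w /=.
  by rewrite has_map; apply: eq_has => w' /=; rewrite !core_map split2_map ee'.
Qed.

Lemma edge_rule_map k x y : edge_rule (map f s) e' k (f x) (f y) = edge_rule s e k x y.
Proof.
rewrite /edge_rule has_map; apply: eq_has => z /=; rewrite count_map.
by congr (_ < _); apply: eq_count => p; rewrite /= /p4 !ee'.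
Qed.

End RulesMap.

Lemma vertex_rule_map (T T' : eqType) (f : T -> T') s (e : rel T) (e' : rel T') k v :
  injective f -> (forall x y, e' (f x) (f y) = e x y) ->
  vertex_rule (map f s) e' k (f v) = vertex_rule s e k v.
Proof.
move=> f_inj ee'; rewrite /vertex_rule (twin_rule_map _ f_inj ee').
rewrite !(chain_rule_map _ f_inj ee') (@chain_rule_map _ _ f s (compl e)) // => x y.
by rewrite /compl (inj_eq f_inj) ee'.
Qed.

Definition cographic (T : finType) (e : rel T) (D : {set T}) : Prop :=
  forall a b c d, a \in D -> b \in D -> c \in D -> d \in D -> ~~ p4 e a b c d.

Definition module (T : finType) (e : rel T) (M : {set T}) : Prop :=
  forall x y z, x \in M -> y \in M -> z \notin M -> e z x = e z y.

Section Reflect.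

Variables (T : finType) (e : rel T).

Lemma has_enumP (P : pred T) : reflect (exists x, P x) (has P (enum T)).
Proof.
apply: (iffP hasP) => [[x _ Px]|[x Px]]; exists x => //.
by rewrite mem_enum.
Qed.

Lemma count_enum (P : pred T) : count P (enum T) = #|[set x | P x]|.
Proof. by rewrite cardsE cardE -size_filter enumT. Qed.

Lemma modulebP (M : pred T) : reflect (module e [set x | M x]) (moduleb (enum T) e M).
Proof.
apply: (iffP idP) => [H x y z|H].
  rewrite !inE => Mx My Mz; apply/eqP; apply: contraNT H => H.
  apply/has_enumP; exists x; apply/has_enumP; exists y; apply/has_enumP; exists z.
  by rewrite Mx My Mz.
apply/negP => /has_enumP[x /has_enumP[y /has_enumP[z /and4P[Mx My Mz]]]].
by rewrite (H x y z) ?eqxx // inE.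
Qed.

Lemma cographbP (M : pred T) : reflect (cographic e [set x | M x]) (cographb (enum T) e M).
Proof.
apply: (iffP idP) => [H a b c d|H].
  rewrite !inE => Ma Mb Mc Md; apply: contraNN H => H.
  apply/has_enumP; exists a; apply/has_enumP; exists b; apply/has_enumP; exists c.
  by apply/has_enumP; exists d; rewrite Ma Mb Mc Md.
apply/negP => /has_enumP[a /has_enumP[b /has_enumP[c /has_enumP[d]]]].
by case/and5P => Ma Mb Mc Md; apply/negP; apply: H; rewrite inE.
Qed.

End Reflect.

(** * Decomposition of cographs *)

Lemma compl_sym (T : eqType) (e : rel T) : symmetric e -> symmetric (compl e).
Proof. by move=> es x y; rewrite /compl eq_sym es. Qed.

Lemma compl_irr (T : eqType) (e : rel T) : irreflexive (compl e).
Proof. by move=> x; rewrite /compl eqxx. Qed.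

Lemma complK (T : eqType) (e : rel T) : irreflexive e -> compl (compl e) =2 e.
Proof.
move=> ei x y; rewrite /compl; case: eqP => [->|_] /=; first by rewrite ei.
by rewrite negbK.
Qed.

Lemma p4_neq (T : eqType) (e : rel T) a b c d : symmetric e ->
  p4 e a b c d -> [/\ a != c, b != d & a != d].
Proof.
move=> es /and5P[ab bc cd ac /andP[bd ad]]; split.
- by apply: contraNneq ad => ->.
- by apply: contraNneq ad => <-.
- by apply: contraNneq bd => <-; rewrite es.
Qed.

(** The path on four vertices is self-complementary: the complement of [a b c d] is the path
    [b d a c]. *)
Lemma p4_compl (T : eqType) (e : rel T) a b c d : symmetric e ->
  p4 (compl e) a b c d -> p4 e b d a c.
Proof.
move=> es P; have [nac nbd nad] := p4_neq (compl_sym es) P.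
move: P; rewrite /p4 /compl nac nbd nad /= !negbK.
by case/and5P=> /andP[_ ab] /andP[_ bc] /andP[_ cd] -> /andP[-> ad];
   rewrite (es d a) ad (es b a) (es d c) ab bc cd.
Qed.

Lemma cographic_compl (T : finType) (e : rel T) (D : {set T}) :
  symmetric e -> cographic e D -> cographic (compl e) D.
Proof.
by move=> es H a b c d aD bD cD dD; apply/negP => /(p4_compl es); apply/negP/H.
Qed.

Lemma eq_cographic (T : finType) (e e' : rel T) (D : {set T}) :
  {in D &, e =2 e'} -> cographic e D -> cographic e' D.
Proof.
move=> ee H a b c d aD bD cD dD; have := H a b c d aD bD cD dD.
by rewrite /p4 !ee.
Qed.

Lemma cographicS (T : finType) (e : rel T) (D D' : {set T}) :
  D' \subset D -> cographic e D -> cographic e D'.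
Proof. by move=> /subsetP sD H a b c d /sD ? /sD ? /sD ? /sD ?; apply: H. Qed.

Lemma cographic_compl_iff (T : finType) (e : rel T) (D : {set T}) :
  symmetric e -> irreflexive e -> cographic (compl e) D <-> cographic e D.
Proof.
move=> es ei; split; last exact: cographic_compl.
move/(cographic_compl (compl_sym es)); apply: eq_cographic => x y _ _.
exact: complK.
Qed.

Lemma module_compl (T : finType) (e : rel T) (M : {set T}) :
  module e M -> module (compl e) M.
Proof.
move=> mM x y z xM yM zM; rewrite /compl (mM x y z) //.
by rewrite !(memPnC zM).
Qed.

Lemma module_compl_iff (T : finType) (e : rel T) (M : {set T}) :
  irreflexive e -> module (compl e) M <-> module e M.
Proof.
move=> ei; split; last exact: module_compl.
by move/module_compl => mM x y z xM yM zM; have := mM x y z xM yM zM; rewrite !complK.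
Qed.

Section Split.

Variables (T : finType) (e : rel T).
Hypotheses (es : symmetric e) (ei : irreflexive e).

(** [op = false] is a disjoint union and [op = true] a join; the Boolean lets later arguments treat
    both at once. *)
Definition splittable (X : {set T}) : Prop := exists (B : {set T}) (op : bool),
  [/\ B != set0, B \proper X & forall x y, x \in B -> y \in X :\: B -> e x y = op].

(** The part split off consists of the non-neighbours of [v] in [B1]: an edge from such an [x] to a
    neighbour [y] of [v] in [B1] would give the induced path [x y v b]. *)
Lemma splittable_nonneighbours (X B1 B2 : {set T}) v n b :
  v \in X -> X :\ v = B1 :|: B2 -> (forall x y, x \in B1 -> y \in B2 -> e x y = false) ->
  n \in B1 -> ~~ e v n -> b \in B2 -> e v b -> cographic e X -> splittable X.
Proof.
move=> vX XE anti nB1 vn bB2 vb cX.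
have B1X x : x \in B1 -> (x != v) && (x \in X).
  by move=> xB; have : x \in X :\ v by [rewrite XE inE xB]; rewrite !inE.
have B2X x : x \in B2 -> (x != v) && (x \in X).
  by move=> xB; have : x \in X :\ v by [rewrite XE inE xB orbT]; rewrite !inE.
exists [set x in B1 | ~~ e v x], false; split.
- by apply/set0Pn; exists n; rewrite inE nB1.
- apply/properP; split; first by apply/subsetP => x; rewrite inE => /andP[/B1X/andP[]].
  by exists v => //; rewrite inE negb_and; case: (boolP (v \in B1)) => // /B1X;
    rewrite eqxx.
move=> x y; rewrite !inE => /andP[xB vx] /andP[nyB yX].
have [->|yv] := eqVneq y v; first by rewrite es (negbTE vx).
have : y \in B1 :|: B2 by rewrite -XE !inE yv.
rewrite inE => /orP[yB1|/(anti x y xB)//].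
move: nyB; rewrite yB1 /= negbK => vy; apply/negP => xy.
have /negP := cX x y v b (proj2 (andP (B1X _ xB))) yX vX (proj2 (andP (B2X _ bB2))).
by apply; rewrite /p4 xy es vy vb es vx !anti.
Qed.

(** The set [X :\ v] has two mutually nonadjacent sides. If [v] misses a whole side, that side
    splits off; if [v] is adjacent to everything, [v] does; otherwise [v] has a non-neighbour on one
    side and a neighbour on the other. *)
Lemma splittable_add (X B : {set T}) v :
  v \in X -> B != set0 -> B \proper X :\ v ->
  (forall x y, x \in B -> y \in (X :\ v) :\: B -> e x y = false) ->
  cographic e X -> splittable X.
Proof.
move=> vX B0 /properP[/subsetP sB [w wX wB]] anti cX.
pose B' := (X :\ v) :\: B.
have XE : X :\ v = B :|: B'.
  apply/setP => x; rewrite !inE; case: (boolP (x \in B)) => // /sB.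
  by rewrite !inE.
have B'0 : w \in B' by rewrite inE wB.
have anti' x y : x \in B' -> y \in B -> e x y = false by move=> ? ?; rewrite es anti.
have [vB|] := boolP [forall b in B, ~~ e v b].
  exists B, false; split=> //.
    apply/properP; split; first by apply/subsetP => x /sB; rewrite !inE => /andP[].
    by exists w => //; move: wX; rewrite !inE => /andP[].
  move=> x y xB; rewrite inE => /andP[yB yX].
  have [->|yv] := eqVneq y v; first by rewrite es (negbTE (forall_inP vB _ xB)).
  by apply: anti => //; rewrite !inE yB yv.
rewrite negb_forall => /existsP[b1]; rewrite negb_imply negbK => /andP[b1B vb1].
have [vB'|] := boolP [forall b in B', ~~ e v b].
  exists B', false; split=> //; first by apply/set0Pn; exists w.
    apply/properP; split; first by apply/subsetP => x; rewrite !inE => /and3P[].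
    by exists v => //; rewrite !inE eqxx andbF.
  move=> x y xB; rewrite inE => /andP[yB yX].
  have [->|yv] := eqVneq y v; first by rewrite es (negbTE (forall_inP vB' _ xB)).
  by apply: anti' => //; move: yB; rewrite !inE yv yX !andbT negbK.
rewrite negb_forall => /existsP[b2]; rewrite negb_imply negbK => /andP[b2B vb2].
have [vX'|] := boolP [forall b in X :\ v, e v b].
  exists [set v], true; split.
  - by apply/set0Pn; exists v; rewrite inE.
  - apply/properP; split; first by rewrite sub1set.
    by move: wX; rewrite !inE => /andP[wv wX]; exists w => //; rewrite inE.
  - by move=> x y; rewrite inE => /eqP-> /(forall_inP vX').
rewrite negb_forall => /existsP[n]; rewrite negb_imply XE inE => /andP[/orP[] nB vn].
- exact: (splittable_nonneighbours vX XE anti nB vn b2B vb2).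
- by apply: (splittable_nonneighbours vX _ anti' nB vn b1B vb1); rewrite // setUC.
Qed.

End Split.

Lemma cograph_splittable (T : finType) (e : rel T) (X : {set T}) :
  symmetric e -> irreflexive e -> cographic e X -> 1 < #|X| -> splittable e X.
Proof.
move=> es ei; move: {2}#|X| (leqnn #|X|) => n; elim: n X => [|n IH] X; first by lia.
move=> leX cX X1.
have /set0Pn[v vX] : X != set0 by rewrite -card_gt0; lia.
have cardX : #|X| = #|X :\ v|.+1 by rewrite (cardsD1 v) vX.
have [X2|X2] := leqP #|X :\ v| 1.
  have /cards1P[w wE] : #|X :\ v| == 1 by lia.
  have wX : w \in X :\ v by rewrite wE inE.
  exists [set v], (e v w); split.
  - by apply/set0Pn; exists v; rewrite inE.
  - apply/properP; split; first by rewrite sub1set.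
    by move: wX; rewrite !inE => /andP[wv wX]; exists w => //; rewrite inE.
  - by move=> x y; rewrite inE => /eqP->; rewrite wE inE => /eqP->.
have cX' : cographic e (X :\ v) by apply: cographicS cX; rewrite subD1set.
have [|//|B [[] [B0 pB anti]]] := IH (X :\ v) _ cX'; first by lia.
(* A join is a disjoint union in the complement; passing back negates the Boolean. *)
- have [||C [op [C0 pC opC]]] := @splittable_add _ (compl e) (compl_sym es) X B v vX B0 pB.
  + move=> x y xB; rewrite inE => /andP[yB yX].
    by rewrite /compl anti ?andbF // inE yB.
  + exact: cographic_compl.
  exists C, (~~ op); split=> // x y xC yC; rewrite -(opC x y xC yC) /compl.
  have -> : x != y by apply: contraTneq xC => ->; move: yC; rewrite inE => /andP[].
  by rewrite /= negbK.
- exact: splittable_add anti cX.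
Qed.

(** * Vertices around a module *)

Section Closure.

Variables (T : finType) (e : rel T).
Hypothesis es : symmetric e.

Definition closure2 (u v : T) : {set T} := [set x | split2 (enum T) e u v x].

Lemma closure2P u v x : reflect
  (split1 e u v x \/ exists2 y, split1 e u v y & e x y != e x u) (x \in closure2 u v).
Proof.
rewrite inE /split2; apply: (iffP orP) => -[]; try by left.
- by case/has_enumP => y /andP[]; right; exists y.
- by case=> y ? ?; right; apply/has_enumP; exists y; apply/andP.
Qed.

Lemma closure2_l u v : u \in closure2 u v.
Proof. by apply/closure2P; left; rewrite /split1 eqxx. Qed.

Lemma closure2_r u v : v \in closure2 u v.
Proof. by apply/closure2P; left; rewrite /split1 eqxx orbT. Qed.

Lemma closure2_sub u v (C : {set T}) : module e C -> u \in C -> v \in C ->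
  closure2 u v \subset C.
Proof.
move=> mC uC vC.
have S1 x : split1 e u v x -> x \in C.
  by case/or3P => [/eqP->|/eqP->|] //; apply: contraNT => xC; rewrite (mC u v).
apply/subsetP => x /closure2P[/S1 //|[y /S1 yC]].
by apply: contraNT => xC; rewrite (mC y u).
Qed.

(** Suppose an outside [z] distinguishes a second-round vertex [y] from [u]. Then [y], [z], [u], [v]
    and the first-round vertex [a] that brought in [y] contain an induced path, which the cographic
    [C] excludes. *)
Lemma closure2_module u v (C : {set T}) : module e C -> cographic e C ->
  u \in C -> v \in C -> module e (closure2 u v).
Proof.
move=> mC cC uC vC; have /subsetP sC := closure2_sub mC uC vC.
suff H y z : y \in closure2 u v -> z \notin closure2 u v -> e z y = e z u.
  by move=> x y z xS yS zS; rewrite !H.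
move=> yS zS; have [zC|zC] := boolP (z \in C); last by rewrite (mC y u) // sC.
have zE a : split1 e u v a -> e z a = e z u.
  by move=> aS; apply/eqP; apply: contraNT zS => za; apply/closure2P; right; exists a.
have [/zE //|ySn] := boolP (split1 e u v y).
have [a aS ya] : exists2 a, split1 e u v a & e y a != e y u.
  by case/closure2P: yS => // yS; rewrite yS in ySn.
have aC : a \in C by apply: sC; apply/closure2P; left.
have yC : y \in C by apply: sC; apply/closure2P; right; exists a.
have zv : e z v = e z u by apply: zE; rewrite /split1 eqxx orbT.
have yv : e y v = e y u.
  by move: ySn; rewrite /split1 !negb_or negbK => /and3P[_ _ /eqP].
have av : e a u != e a v.
  case/or3P: aS => // /eqP aE; first by rewrite aE eqxx in ya.
  by rewrite aE yv eqxx in ya.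
apply/eqP; apply/negPn/negP => zy.
have za := zE a aS.
have F p q r s (pC : p \in C) (qC : q \in C) (rC : r \in C) (sC' : s \in C) :
  ~~ p4 e p q r s by apply: cC.
(* These eight candidate paths refute every choice of the six remaining adjacencies that is
   compatible with [zy], [ya] and [av]. *)
move: (F _ _ _ _ yC vC zC aC) (F _ _ _ _ yC uC zC aC) (F _ _ _ _ yC aC zC vC)
  (F _ _ _ _ yC aC zC uC) (F _ _ _ _ zC yC uC aC) (F _ _ _ _ zC yC vC aC)
  (F _ _ _ _ zC yC aC uC) (F _ _ _ _ zC yC aC vC) zy ya av.
rewrite /p4 (es v z) (es u z) (es a z) (es y z) (es u a) (es v a) yv zv za.
by case: (e z y); case: (e z u); case: (e y u); case: (e y a); case: (e a u); case: (e a v).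
Qed.

End Closure.

Section ChainRule.

Variables (T : finType) (e : rel T).

Definition core_set (u v : T) : {set T} := [set w | core (enum T) e u v w].

Lemma core_setP u v w : reflect
  (w \in closure2 e u v /\ exists z, [/\ z \in closure2 e u v, ~~ e z v & ~~ e z w])
  (w \in core_set u v).
Proof.
rewrite [X in reflect _ X]inE /core; apply: (iffP andP) => -[h1].
- by case/has_enumP => z /and3P[? ? ?]; split; [rewrite inE | exists z; rewrite inE].
- case=> z [h2 h3 h4]; rewrite inE in h1; rewrite inE in h2; split=> //.
  by apply/has_enumP; exists z; apply/and3P.
Qed.

Lemma chain_ruleP k v : reflect
  (exists u, [/\ module e (closure2 e u v), k.+1 < #|closure2 e u v|,
     cographic e (core_set u v)
   & forall w w', w \in core_set u v -> w' \in closure2 e u v :\: core_set u v -> e w w'])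
  (chain_rule (enum T) e k v).
Proof.
apply: (iffP (has_enumP _)) => -[u].
- case/and4P => h1 h2 h3 h4; exists u; split; try exact/modulebP; try exact/cographbP.
    by rewrite -count_enum.
  move=> w w'; rewrite !inE => h5 /andP[h6 h7]; apply: contraNT h4 => h8.
  by apply/has_enumP; exists w; apply/has_enumP; exists w'; apply/and4P.
- case=> h1 h2 h3 h4; exists u; apply/and4P; split; try exact/modulebP; try exact/cographbP.
    by rewrite count_enum.
  apply/negP => /has_enumP[w /has_enumP[w' /and4P[h5 h6 h7]]].
  by apply/negP; rewrite negbK; apply: h4; rewrite !inE ?h7.
Qed.

End ChainRule.

Lemma p4_free (T : finType) (e : rel T) (D : {set T}) a b c d : cographic e D ->
  a \in D -> b \in D -> c \in D -> d \in D ->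
  e a b -> e b c -> e c d -> ~~ e a c -> ~~ e b d -> ~~ e a d -> False.
Proof.
move=> cD aD bD cD' dD h1 h2 h3 h4 h5 h6; apply: (negP (cD _ _ _ _ aD bD cD' dD)).
by rewrite /p4 h1 h2 h3 h4 h5.
Qed.

(* [W] splits into a core [X] and vertices that do not distinguish the elements
   of [X]; such vertices form two families with nested neighbourhoods. *)
Section Nested.

Variables (T : finType) (e : rel T) (W X : {set T}) (x0 : T).
Hypotheses (es : symmetric e) (ei : irreflexive e).
Hypotheses (x0X : x0 \in X) (XW : X \subset W).
Hypothesis unifX : forall u x, u \in W :\: X -> x \in X -> e u x = e u x0.
Hypothesis cU : cographic e (x0 |: W :\: X).

(** The vertex [x0] stands for all of [X]. Nothing is assumed about the edges inside [X], so that
    affected vertices may hide there. *)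
Definition joined : {set T} := [set u in W :\: X | e u x0].
Definition unjoined : {set T} := [set u in W :\: X | ~~ e u x0].

Lemma base_in_setU : x0 \in x0 |: W :\: X. Proof. by rewrite setU11. Qed.

Lemma joinedP s : s \in joined -> e s x0 /\ s \in x0 |: W :\: X.
Proof. by rewrite inE => /andP[sU h]; rewrite h inE sU orbT. Qed.

Lemma unjoinedP p : p \in unjoined -> ~~ e p x0 /\ p \in x0 |: W :\: X.
Proof. by rewrite inE => /andP[pU h]; rewrite h inE pU orbT. Qed.

(** Incomparable neighbourhoods give an induced path: [p s x0 s'] if [s] and [s'] are nonadjacent,
    else [p s s' p'] if [p] and [p'] are nonadjacent, else [x0 s p p']. *)
Lemma nested s s' p p' : s \in joined -> s' \in joined ->
  p \in unjoined -> p' \in unjoined ->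
  e s p -> ~~ e s p' -> e s' p' -> e s' p.
Proof.
move=> /joinedP[a1 a2] /joinedP[b1 b2] /unjoinedP[c1 c2] /unjoinedP[d1 d2].
move=> sp sp' sp2; apply: contraT => s'p.
have [ss|ss] := boolP (e s s'); last first.
  by case: (p4_free cU c2 a2 base_in_setU b2); rewrite // es.
have [pp|pp] := boolP (e p p'); last first.
  by case: (p4_free cU c2 a2 b2 d2); rewrite // es.
by case: (p4_free cU base_in_setU a2 c2 d2); rewrite // es.
Qed.

Definition joined_class (s : T) : {set T} :=
  [set s' in joined | [forall p in unjoined, e s' p == e s p]].

Lemma joined_classP s s' : reflect
  (s' \in joined /\ forall p, p \in unjoined -> e s' p = e s p) (s' \in joined_class s).
Proof.
rewrite [X in reflect _ X]inE; apply: (iffP andP) => -[sJ H]; split=> //.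
  by move=> p pU; apply/eqP/(forall_inP H).
by apply/forall_inP => p pU; apply/eqP/H.
Qed.

Lemma joined_classify z : z \in W -> [\/ z \in X, z \in joined | z \in unjoined].
Proof.
move=> zW; have [zX|zX] := boolP (z \in X); first by constructor 1.
by have [h|h] := boolP (e z x0); [constructor 2 | constructor 3]; rewrite !inE zX zW h.
Qed.

(** Vertices of [X] are adjacent to every member, and unjoined vertices see the class uniformly by
    its definition. A joined [z] outside the class differs from it at some unjoined [p], and
    distinguishing two members would then give an induced path through [p]. *)
Lemma joined_class_module s : module e W -> s \in joined -> module e (joined_class s).
Proof.
move=> mW sJ.
suff H s1 s2 z : s1 \in joined_class s -> s2 \in joined_class s ->
    z \notin joined_class s -> e z s1 -> e z s2.
  by move=> s1 s2 z h1 h2 hz; apply/idP/idP; apply: H.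
move=> c1 c2 zC.
have /joined_classP[J1 E1] := c1; have /joined_classP[J2 E2] := c2.
have JW t : t \in joined -> t \in W by rewrite !inE => /andP[/andP[]].
have [zW|zW] := boolP (z \in W); last by rewrite (mW s1 s2) // JW.
case: (joined_classify zW) => [zX|zJ|zU].
- have uX t : t \in joined -> e z t.
    by rewrite inE => /andP[tU tx]; rewrite es (unifX tU).
  by rewrite !uX.
- have /existsP[p] : [exists p in unjoined, e z p != e s p].
    apply: contraNT zC; rewrite negb_exists => /forallP H.
    apply/joined_classP; split=> // p pU; apply/eqP; have := H p.
    by rewrite pU /= negbK.
  case/andP=> pU zp z1; apply: contraT => z2; move: zp; rewrite -(E2 _ pU).
  have e12 : e s1 p = e s2 p by rewrite E1 ?E2.
  have [a1 a2] := joinedP J1; have [b1 b2] := joinedP J2.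
  have [c11 c22] := joinedP zJ; have [d1 d2] := unjoinedP pU.
  have [s2p|s2p] := boolP (e s2 p).
    rewrite eqb_id => zp; have s1p : e s1 p by rewrite e12.
    have [ss|ss] := boolP (e s1 s2).
      by case: (p4_free cU c22 base_in_setU b2 d2); rewrite // es.
    by case: (p4_free cU c22 a2 d2 b2); rewrite // es.
  rewrite eqbF_neg negbK => zp; have s1p : ~~ e s1 p by rewrite e12.
  case: (p4_free cU d2 c22 base_in_setU b2); rewrite // es //.
- by rewrite !(es z) E1 // E2.
Qed.

Lemma joined_class_unjoined0 s : unjoined = set0 -> s \in joined -> joined_class s = joined.
Proof.
move=> U0 sJ; apply/setP => t; apply/joined_classP/idP => [[]//|tJ].
by split=> // p; rewrite U0 inE.
Qed.

Lemma joined_class_sub s : joined_class s \subset W :\: X.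
Proof. by apply/subsetP => t /joined_classP[]; rewrite inE => /andP[]. Qed.

Lemma card_joined_unjoined : #|W :\: X| = #|joined| + #|unjoined|.
Proof.
rewrite -cardsUI; have -> : joined :&: unjoined = set0.
  by apply/setP => t; rewrite !inE; case: (e t x0); rewrite ?andbF.
rewrite cards0 addn0; apply: eq_card => t.
by rewrite !inE -andb_orr orbN andbT.
Qed.

Definition nbrs_in_joined (p : T) : {set T} := [set s in joined | e s p].

(** * The extreme end of the chain of nested neighbourhoods *)

Section Chain.

Variables (k : nat) (q : T).
Hypotheses (mW : module e W) (qU : q \in unjoined).
Hypothesis q_min : forall p, p \in unjoined -> #|nbrs_in_joined q| <= #|nbrs_in_joined p|.

Let C := nbrs_in_joined q.

(** If a vertex of [C] missed [p], nestedness would make the neighbourhood of [p] a proper subset of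
    [C], against the choice of [q]. *)
Lemma minimal_nbrs_complete s p : s \in C -> p \in unjoined -> e s p.
Proof.
rewrite inE => /andP[sJ sq] pU; apply: contraT => sp.
have : nbrs_in_joined p \proper C.
  apply/properP; split; last first.
    by exists s; rewrite inE sJ // (negbTE sp).
  apply/subsetP => t; rewrite [t \in nbrs_in_joined p]inE => /andP[tJ tp].
  by rewrite inE tJ (nested sJ tJ qU pU).
by move/proper_card; rewrite ltnNge q_min.
Qed.

Lemma nbrs_in_joined_sub s : s \in C -> s \in joined.
Proof. by rewrite inE => /andP[]. Qed.

(** So [W] is the join of [C] and [W :\: C], the shape that the chain rule asks for. A joined [z]
    outside [C] that misses [s] would give the path [z x0 s q]. *)
Lemma nbrs_complete s z : s \in C -> z \in W :\: C -> e s z.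
Proof.
move=> sC; rewrite inE => /andP[zC zW]; have sJ := nbrs_in_joined_sub sC.
have [a1 a2] := joinedP sJ.
case: (joined_classify zW) => [zX|zJ|]; last exact: minimal_nbrs_complete.
  by rewrite (unifX _ zX) //; move: sJ; rewrite inE => /andP[].
have zq : ~~ e z q by move: zC; rewrite inE zJ.
have [b1 b2] := joinedP zJ; have [c1 c2] := unjoinedP qU.
have sq : e s q by move: sC; rewrite inE => /andP[].
apply: contraT => sz.
by case: (p4_free cU b2 base_in_setU a2 c2); rewrite // es.
Qed.

(** The rule is tried at [c] with [u := q]. The closure [S] of [q] and [c] contains [c] and
    [W :\: C], so more than [k] vertices in the latter would reach the threshold. The core stays
    inside [C], since vertices of [W] outside [C] are adjacent to all of [C]; its being cographic
    therefore involves no vertex of [X]. *)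
Lemma chain_bound c : c \in C -> ~~ chain_rule (enum T) e k c -> #|W :\: C| <= k.
Proof.
move=> cC nochain.
have CW t : t \in C -> t \in W by move/nbrs_in_joined_sub; rewrite !inE => /andP[/andP[]].
have UW t : t \in unjoined -> t \in W by rewrite !inE => /andP[/andP[]].
have qC : q \notin C by rewrite inE ei andbF.
have x0C : x0 \notin C by rewrite inE !inE x0X.
have qM : q \in W :\: C by rewrite inE qC UW.
set S := closure2 e q c.
have SW : S \subset W by apply: closure2_sub => //; [apply: UW | apply: CW].
have x0M : x0 \in W :\: C by rewrite inE x0C (subsetP XW).
have S1I z : split1 e q c z -> z \in S by move=> h; apply/closure2P; left.
have cq : e c q by apply: nbrs_complete.
have x0S1 : split1 e q c x0.
  rewrite /split1; have [h _] := unjoinedP qU; rewrite es in h.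
  by rewrite (negbTE h) es nbrs_complete // !orbT.
(* A vertex that misses [q] distinguishes [q] from [c] and enters in the first round. A vertex
   adjacent to [q] is unjoined, hence misses [x0]; as [x0] entered in the first round, it brings
   that vertex in. *)
have MS : W :\: C \subset S.
  apply/subsetP => y yM; have [yq|yq] := boolP (e y q); last first.
    by apply: S1I; rewrite /split1 (negbTE yq) es nbrs_complete // !orbT.
  have yx : ~~ e y x0.
    move: yM; rewrite inE => /andP[yC yW].
    case: (joined_classify yW) => [yX|yJ|/unjoinedP[]//].
      move: yq; rewrite es (unifX _ yX); last by move: qU; rewrite inE => /andP[].
      by have [h _] := unjoinedP qU; rewrite (negbTE h).
    by move: yC; rewrite inE yJ yq.
  by apply/closure2P; right; exists x0; rewrite // yq eqb_id.
suff : ~ k.+1 < #|S|.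
  move=> leS; have : #|c |: W :\: C| <= #|S|.
    by apply: subset_leq_card; rewrite subUset MS sub1set closure2_r.
  rewrite cardsU1 inE cC add1n => le2; rewrite -ltnS (leq_trans le2) // leqNgt.
  exact/negP.
move=> ltS; move/negP: nochain; apply; apply/chain_ruleP; exists q; rewrite -/S.
have CU t : t \in C -> t \in x0 |: W :\: X by case/nbrs_in_joined_sub/joinedP.
have inC z t : z \in W -> t \in C -> ~~ e z t -> z \in C.
  by move=> zW tC; apply: contraNT => zC; rewrite es nbrs_complete // inE zC.
have Cq t : t \in C -> e t q by move=> tC; apply: nbrs_complete.
have inS z y : split1 e q c y -> e z y != e z q -> z \in S.
  by move=> yS h; apply/closure2P; right; exists y.
split=> //.
(* [S] is a module. Outside [W] this is inherited from [W]; a [z] in [C] outside [S] that misses a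
   [y] in [S] leads to the path [y c z y'], where [y'] brought in [y]. *)
- suff H y z : y \in S -> z \notin S -> e z y = e z q by move=> x y z xS yS zS; rewrite !H.
  move=> yS zS; have [zW|zW] := boolP (z \in W); last by apply: mW => //;
    [apply: (subsetP SW) | apply: UW].
  have zC : z \in C.
    by apply: contraNT zS => zC; apply: (subsetP MS); rewrite inE zC.
  rewrite (Cq _ zC); apply: contraNeq zS; rewrite eqb_id => zy.
  have yC : y \in C by apply: (inC _ z); [apply: (subsetP SW) | | rewrite es].
  have [yS1|yS1] := boolP (split1 e q c y).
    by apply: (inS z y); rewrite ?(negbTE zy) ?Cq.
  case/closure2P: yS => [h|[y' y'S]]; first by rewrite h in yS1.
  rewrite (Cq _ yC) eqb_id => yy'.
  have y'C : y' \in C by apply: (inC _ y); [apply: (subsetP SW); apply: S1I | |rewrite es].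
  have yc : e y c.
    by move: yS1; rewrite /split1 !negb_or negbK (Cq _ yC) => /and3P[_ _ /eqP<-].
  have y'c : ~~ e y' c.
    case/or3P: y'S => [/eqP y'q|/eqP->|]; [by move: y'C;
      rewrite y'q (negbTE qC) | by rewrite ei |].
    by rewrite (Cq _ y'C); case: (e y' c).
  have [//|zc] := boolP (split1 e q c z); first by move/S1I.
  have {zc} zc : e z c.
    by move: zc; rewrite /split1 !negb_or negbK (Cq _ zC) => /and3P[_ _ /eqP<-].
  have [zy'|zy'] := boolP (e z y'); last by apply: (inS z y'); rewrite ?(negbTE zy') ?Cq.
  by case: (p4_free cU (CU _ yC) (CU _ cC) (CU _ zC) (CU _ y'C)); rewrite // es.
- apply: cographicS cU; apply/subsetP => w /core_setP[wS [z [zS zc zw]]].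
  apply: CU; apply: (inC _ z); [exact: (subsetP SW) | | by rewrite es].
  by apply: (inC _ c) => //; apply: (subsetP SW).
- move=> w w' /core_setP[wS [z [zS zc zw]]]; rewrite inE => /andP[w'K w'S].
  have zC : z \in C by apply: (inC _ c) => //; apply: (subsetP SW).
  have wC : w \in C by apply: (inC _ z) => //; [apply: (subsetP SW) | rewrite es].
  have [w'C|w'C] := boolP (w' \in C); last first.
    by apply: nbrs_complete => //; rewrite inE w'C (subsetP SW).
  apply: contraNT w'K => ww'.
  have K t : t \in S -> ~~ e t c -> ~~ e t w' -> w' \in core_set e q c.
    by move=> tS tc tw; apply/core_setP; split=> //; exists t.
  have [wc|] := boolP (e w c); last by move/(K w wS); apply.
  have [zw'|] := boolP (e z w'); last by apply: K zc.
  have [cw'|] := boolP (e c w'); last by apply: K; rewrite ?closure2_r ?ei.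
  by case: (p4_free cU (CU _ wC) (CU _ cC) (CU _ w'C) (CU _ zC)); rewrite // es.
Qed.

End Chain.

(** The summand [k] bounds [W :\: C] by the chain rule, where [C] is the smallest neighbourhood. The
    summand [k.+1] bounds [C], whose vertices are adjacent to all unjoined ones and so belong to one
    joined class. *)
Lemma chain_end_bound k s0 p0 :
  module e W -> (forall D, module e D -> cographic e D -> #|D| <= k.+1) ->
  (forall v, ~~ chain_rule (enum T) e k v) ->
  s0 \in joined -> (forall p, p \in unjoined -> e s0 p) -> p0 \in unjoined ->
  #|W :\: X| <= k + k.+1.
Proof.
move=> mW small nochain s0J s0U p0U.
have [q qU q_min] := @arg_minnP _ p0 (fun p => p \in unjoined) (fun p => #|nbrs_in_joined
  p|) p0U.
have s0C : s0 \in nbrs_in_joined q by rewrite inE s0J s0U.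
have := chain_bound mW qU q_min s0C (nochain s0).
have leC : #|nbrs_in_joined q| <= k.+1.
  apply: leq_trans (subset_leq_card _) (small (joined_class s0) _ _).
  - apply/subsetP => s sC; apply/joined_classP; split; first exact: nbrs_in_joined_sub sC.
    by move=> p pU; rewrite s0U // (minimal_nbrs_complete qU q_min sC).
  - exact: joined_class_module.
  - by apply: cographicS cU; apply: subset_trans (joined_class_sub s0) (subsetUr _ _).
have : #|W :\: X| <= #|(W :\: nbrs_in_joined q) :|: nbrs_in_joined q|.
  apply: subset_leq_card; apply/subsetP => t; rewrite inE => /andP[_ tW].
  by rewrite in_setU in_setD tW andbT orNb.
move=> le1 le2; apply: leq_trans le1 _; apply: leq_trans (leq_card_setU _ _) _.
exact: leq_add.
Qed.

End Nested.

(** * The size of a reduced graph *)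

Definition added (T : finType) (e h : rel T) : {set {set T}} :=
  [set [set z.1; z.2] | z : T * T & h z.1 z.2 && ~~ e z.1 z.2].

Definition completable (T : finType) (e : rel T) (k : nat) : Prop :=
  exists h : rel T, [/\ symmetric h, irreflexive h, subrel e h,
    cographic h setT & #|added e h| <= k].

Lemma mem_added (T : finType) (e h : rel T) x y : symmetric e -> symmetric h ->
  ([set x; y] \in added e h) = h x y && ~~ e x y.
Proof.
move=> es hs; apply/imsetP/idP => [[[z w] /= + E]|H]; last first.
  by exists (x, y); rewrite ?inE.
have xE : x \in [set z; w] by rewrite -E !inE eqxx.
have yE : y \in [set z; w] by rewrite -E !inE eqxx orbT.
have zE : z \in [set x; y] by rewrite E !inE eqxx.
have wE : w \in [set x; y] by rewrite E !inE eqxx orbT.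
rewrite inE /=; move: xE yE zE wE; rewrite !inE.
move=> /orP[]/eqP-> /orP[]/eqP-> //; rewrite ?orbb.
- by move=> _ /eqP->.
- by rewrite hs es.
- by move=> /eqP->.
Qed.

Lemma card_fibres (T : finType) (f : T -> nat) (S : {set T}) a b :
  (forall x, x \in S -> f x < a) ->
  (forall x, x \in S -> #|[set y in S | f y == f x]| <= b) -> #|S| <= a * b.
Proof.
elim: a S => [|a IH] S ltS leS.
  rewrite leqn0 cards_eq0; apply/set0Pn => -[x /ltS]; by [].
rewrite -(cardsID [set x | f x == a]) mulSn; apply: leq_add.
  have [->|/set0Pn[x]] := eqVneq (S :&: [set x | f x == a]) set0; first by rewrite cards0.
  rewrite !inE => /andP[xS /eqP fx]; apply: leq_trans (leS x xS).
  by apply: subset_leq_card; apply/subsetP => y; rewrite !inE fx.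
apply: IH => x; rewrite !inE => /andP[xa xS].
  by have := ltS x xS; rewrite ltnS leq_eqVlt (negbTE xa).
apply: leq_trans (leS x xS); apply: subset_leq_card; apply/subsetP => y.
by rewrite !inE => /andP[/andP[_ ->] ->].
Qed.

Lemma compl_joined (T : finType) (e : rel T) (W X : {set T}) x0 : x0 \in X ->
  joined (compl e) W X x0 = unjoined e W X x0.
Proof.
move=> xX; apply/setP => u; rewrite !inE /compl.
by case: eqVneq => [->|]; rewrite ?xX.
Qed.

Lemma compl_unjoined (T : finType) (e : rel T) (W X : {set T}) x0 : x0 \in X ->
  unjoined (compl e) W X x0 = joined e W X x0.
Proof.
move=> xX; apply/setP => u; rewrite !inE /compl.
by case: eqVneq => [->|]; rewrite ?xX // negbK.
Qed.

Section Reduced.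

Variables (T : finType) (e h : rel T) (k : nat).
Hypotheses (es : symmetric e) (ei : irreflexive e).
Hypotheses (hs : symmetric h) (hi : irreflexive h) (eh : subrel e h).
Hypotheses (ch : cographic h setT) (leF : #|added e h| <= k).
Hypothesis novertex : forall v, ~~ vertex_rule (enum T) e k v.
Hypothesis noedge : 0 < k -> forall x y, ~~ edge_rule (enum T) e k x y.

Lemma completion_cographic D : cographic h D.
Proof. by apply: cographicS ch; apply: subsetT. Qed.

(** The twin rule fails at a vertex [v] of [C], while every [u] in [C] is a twin of [v]: the closure
    of the two lies in [C] and is again a cographic module. *)
Lemma small_module C : module e C -> cographic e C -> #|C| <= k.+1.
Proof.
move=> mC cC; have [->|/set0Pn[v vC]] := eqVneq C set0; first by rewrite cards0.
have := novertex v; rewrite !negb_or => /and3P[+ _ _]; rewrite -leqNgt.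
apply: leq_trans; rewrite count_enum; apply: subset_leq_card; apply/subsetP => u uC.
rewrite inE; apply/andP; split; [apply/modulebP | apply/cographbP].
  exact: (closure2_module es mC).
by apply: cographicS cC; exact: closure2_sub.
Qed.

Definition unaffected : {set T} := [set u | [forall y, h u y == e u y]].

Lemma unaffectedP u : u \in unaffected -> forall y, h u y = e u y.
Proof. by rewrite inE => /forallP H y; apply/eqP. Qed.

Lemma small_unaffected_module C : module h C -> C \subset unaffected -> #|C| <= k.+1.
Proof.
move=> mC /subsetP uC; apply: small_module.
  move=> x y z xC yC zC.
  by rewrite !(es z) -!(unaffectedP (uC _ _)) // !(hs _ z); apply: mC.
apply: (@eq_cographic _ h); last exact: completion_cographic.
by move=> x y xC _; apply: unaffectedP; apply: uC.
Qed.

(** * Unaffected vertices of a module outside its minimal part *)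

Section Chunk.

Variables W X : {set T}.
Hypotheses (mW : module h W) (mX : module h X) (XW : X \subset W).
Hypothesis U_unaff : W :\: X \subset unaffected.

Lemma unaffected_edge u y : u \in W :\: X -> h u y = e u y.
Proof. by move=> uU; apply: unaffectedP; apply: (subsetP U_unaff). Qed.

(** As [W] is a module of [h], [y] is adjacent to all of [W :\: X]. So each unjoined [p] missed by a
    joined [s] gives an induced path [x s y p], and the edge rule allows at most [k] of them. The
    bound adds up [k + 1] possible sizes of the nested sets [N s], each for at most [k + 1] joined
    vertices, then [k] unjoined vertices missed by some joined one, all contained in the largest
    [N s], and [k + 1] missed by none. *)
Lemma chunk_exit x y : x \in X -> y \notin W -> h x y -> ~~ e x y ->
  #|W :\: X| <= k.+1 * k.+1 + (k + k.+1).
Proof.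
move=> xX yW hxy exy.
have k0 : 0 < k.
  apply: leq_trans leF; rewrite card_gt0; apply/set0Pn; exists [set x; y].
  by rewrite mem_added // hxy.
have unif u z : u \in W :\: X -> z \in X -> h u z = h u x.
  by rewrite inE => /andP[uX _] zX; apply: mX.
set J := joined h W X x; set P := unjoined h W X x.
pose N s := [set p in P | ~~ h s p].
have JU s : s \in J -> s \in W :\: X by rewrite inE => /andP[].
have PU p : p \in P -> p \in W :\: X by rewrite inE => /andP[].
have Uy u : u \in W :\: X -> h y u.
  by rewrite inE => /andP[_ uW]; rewrite (mW uW (subsetP XW _ xX)) // hs.
have leN s : s \in J -> #|N s| <= k.
  move=> sJ; have := noedge k0 x y; rewrite leqNgt; apply: contraNN => ltN.
  apply/has_enumP; exists s; apply: leq_trans ltN _; rewrite count_enum.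
  apply: subset_leq_card; apply/subsetP => p; rewrite !inE => /andP[pP sp].
  have pU : p \in W :\: X by move: pP; rewrite -in_setD => /andP[].
  have px : ~~ h p x by move: pP => /andP[].
  have sx : h s x by move: sJ; rewrite inE => /andP[].
  have sU := JU s sJ.
  rewrite /p4 exy es -unaffected_edge // sx -unaffected_edge // hs Uy //= es
    -unaffected_edge // hs Uy //=.
  by rewrite -unaffected_edge // sp es -unaffected_edge.
have cU : cographic h (x |: W :\: X) by apply: completion_cographic.
have nest s s' : s \in J -> s' \in J -> #|N s'| <= #|N s| -> N s' \subset N s.
  move=> sJ s'J leN'; apply/subsetP => p /setIdP[pP s'p].
  apply/setIdP; split=> //; apply: contraTN leN' => sp; rewrite -ltnNge.
  apply: proper_card; apply/properP; split; last first.
    by exists p; [apply/setIdP | apply/negP => /setIdP[_]; rewrite sp].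
  apply/subsetP => p' /setIdP[p'P sp']; apply/setIdP; split=> //.
  by apply: contra s'p => s'p'; apply: (nested hs cU sJ s'J pP p'P).
(* The relation [r] will be [h] and then its complement, where unjoined vertices become the joined
   ones. *)
have smallC r s : symmetric r -> irreflexive r -> cographic r setT -> module r W ->
    (forall u z, u \in W :\: X -> z \in X -> r u z = r u x) ->
    (forall D, module r D -> D \subset unaffected -> #|D| <= k.+1) ->
    s \in joined r W X x -> #|joined_class r W X x s| <= k.+1.
  move=> rs ri cr rW runif rsmall sJ; apply: rsmall.
    by apply: joined_class_module => //; apply: cographicS cr; apply: subsetT.
  exact: subset_trans (joined_class_sub _ _ _ _ _) U_unaff.
rewrite (card_joined_unjoined h W X x); apply: leq_add.
  apply: (@card_fibres _ (fun s => #|N s|)) => s sJ; first by rewrite ltnS leN.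
  apply: leq_trans (smallC h s hs hi ch mW unif small_unaffected_module sJ).
  apply: subset_leq_card; apply/subsetP => t /setIdP[tJ /eqP Nt].
  apply/joined_classP; split=> // p pP; have /setP/(_ p) : N t = N s.
    by apply/eqP; rewrite eqEsubset !nest ?Nt.
  have NE u : (p \in N u) = ~~ h u p by apply/setIdP/idP => [[]|].
  by rewrite !NE => /negb_inj.
have smallP p : p \in P -> #|joined_class (compl h) W X x p| <= k.+1.
  move=> pP; apply: smallC.
  - exact: compl_sym.
  - exact: compl_irr.
  - exact: cographic_compl.
  - exact: module_compl.
  - move=> u z uU zX; rewrite /compl (unif u z) //.
    by move: uU; rewrite inE => /andP[uX _]; rewrite !(memPnC uX).
  - by move=> D /(module_compl_iff _ hi)/small_unaffected_module.
  - by rewrite compl_joined.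
pose Z := [set p in P | [forall s in J, h s p]].
rewrite addnC -(cardsID Z P) setIC; apply: leq_add.
  have [->|/set0Pn[p]] := eqVneq (Z :&: P) set0; first by rewrite cards0.
  move=> /setIP[/setIdP[pP /forall_inP pZ] _]; apply: leq_trans (smallP p pP).
  apply: subset_leq_card; apply/subsetP => p' /setIP[/setIdP[p'P /forall_inP p'Z] _].
  apply/joined_classP; rewrite compl_joined // compl_unjoined //; split=> // s sJ.
  by rewrite /compl !(hs _ s) pZ // p'Z // !andbF.
have [->|/set0Pn[p]] := eqVneq (P :\: Z) set0; first by rewrite cards0.
rewrite in_setD => /andP[pZ pP].
have /existsP[s0 /andP[s0J _]] : [exists s in J, ~~ h s p].
  apply: contraNT pZ => H; apply/setIdP; split=> //; apply/forall_inP => s sJ.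
  by apply: contraNT H => sp; apply/existsP; exists s; rewrite sJ.
have [s sJ s_max] := @arg_maxnP _ s0 (fun s => s \in J) (fun s => #|N s|) s0J.
apply: leq_trans (leN s sJ); apply: subset_leq_card; apply/subsetP => p'.
rewrite in_setD => /andP[p'Z p'P].
have /existsP[s' /andP[s'J sp']] : [exists s in J, ~~ h s p'].
  apply: contraNT p'Z => H; apply/setIdP; split=> //; apply/forall_inP => t tJ.
  by apply: contraNT H => tp; apply/existsP; exists t; rewrite tJ.
by apply: (subsetP (nest s s' sJ s'J (s_max s' s'J))); apply/setIdP.
Qed.

(** Here [W] is also a module of [e]. The unjoined [q] with fewest joined neighbours decides which
    end of the chain to use. If it has a joined neighbour, that neighbour is adjacent to all
    unjoined vertices; if it has none, then in [compl e] the vertex [q] is adjacent to all of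
    [joined], and the same bound applies to the complement. *)
Lemma chunk_noexit x : x \in X ->
  (forall z y, z \in X -> y \notin W -> h z y = e z y) ->
  #|W :\: X| <= k + k.+1.
Proof.
move=> xX noexit.
have xU : x \notin W :\: X by rewrite inE xX.
have eW : module e W.
  move=> y z t yW zW tW.
  suff H u : u \in W -> e t u = h t u by rewrite !H // (mW yW zW tW).
  move=> uW; have [uX|uX] := boolP (u \in X); first by rewrite (es t) (hs t) noexit.
  by rewrite (es t) (hs t) unaffected_edge // inE uX.
have unif u z : u \in W :\: X -> z \in X -> e u z = e u x.
  by move=> uU zX; rewrite -!unaffected_edge //; move: uU; rewrite inE => /andP[uX _];
    apply: mX.
have cU : cographic e (x |: W :\: X).
  apply: (@eq_cographic _ h); last exact: completion_cographic.
  move=> y z; rewrite !in_setU1 => /orP[/eqP->|yU] /orP[/eqP->|zU].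
  - by rewrite ei hi.
  - by rewrite hs es unaffected_edge.
  - by rewrite unaffected_edge.
  - by rewrite unaffected_edge.
have unif' u z : u \in W :\: X -> z \in X -> compl e u z = compl e u x.
  move=> uU zX; rewrite /compl (unif u z) //.
  by move: uU; rewrite inE => /andP[uX _]; rewrite !(memPnC uX).
have small' D : module (compl e) D -> cographic (compl e) D -> #|D| <= k.+1.
  by move=> /(module_compl_iff _ ei) mD /(cographic_compl_iff _ es ei); apply: small_module.
have chain1 v : ~~ chain_rule (enum T) e k v.
  by have := novertex v; rewrite !negb_or => /and3P[].
have chain2 v : ~~ chain_rule (enum T) (compl e) k v.
  by have := novertex v; rewrite !negb_or => /and3P[].
have cs := compl_sym es; have ci := @compl_irr _ e.
have cU' := cographic_compl es cU.
have eW' := module_compl eW.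
have one r : symmetric r -> cographic r (x |: W :\: X) -> module r W ->
    (forall u z, u \in W :\: X -> z \in X -> r u z = r u x) ->
    (forall D, module r D -> cographic r D -> #|D| <= k.+1) ->
    unjoined r W X x = set0 -> #|joined r W X x| <= k.+1.
  move=> rs cr rW runif rsmall U0.
  have [->|/set0Pn[s sJ]] := eqVneq (joined r W X x) set0; first by rewrite cards0.
  rewrite -(joined_class_unjoined0 U0 sJ); apply: rsmall.
    exact: joined_class_module.
  apply: cographicS cr; apply: subset_trans (joined_class_sub _ _ _ _ _) _.
  exact: subsetUr.
have [U0|/set0Pn[p0 p0U]] := eqVneq (unjoined e W X x) set0.
  rewrite (card_joined_unjoined e W X x) U0 cards0 addn0.
  by apply: leq_trans (one e es cU eW unif small_module U0) _; apply: leq_addl.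
have [J0|/set0Pn[s sJ]] := eqVneq (joined e W X x) set0.
  rewrite (card_joined_unjoined e W X x) J0 cards0 -(@compl_joined _ e) //.
  apply: leq_trans (one _ cs cU' eW' unif' small' _) _; last exact: leq_addl.
  by rewrite compl_unjoined.
have [q qU q_min] := @arg_minnP _ p0 (fun p => p \in unjoined e W X x)
  (fun p => #|nbrs_in_joined e W X x p|) p0U.
have [C0|/set0Pn[c cC]] := eqVneq (nbrs_in_joined e W X x q) set0; last first.
  apply: (@chain_end_bound _ e W X x es ei xX XW unif cU k c p0) => //.
  - exact: small_module.
  - exact: nbrs_in_joined_sub cC.
  - by move=> p pU; apply: (minimal_nbrs_complete es cU qU q_min cC).
apply: (@chain_end_bound _ (compl e) W X x cs ci xX XW unif' cU' k q s) => //.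
- by rewrite compl_joined.
- rewrite compl_unjoined // => t tJ.
  have tq : ~~ e t q.
    apply/negP => tq; have : t \in nbrs_in_joined e W X x q by apply/setIdP.
    by rewrite C0 inE.
  rewrite /compl es tq andbT.
  by apply: contraTneq qU => ->; move: tJ => /setIdP[_ tx]; rewrite inE tx andbF.
- by rewrite compl_unjoined.
Qed.

Lemma chunk_bound : X != set0 -> #|W :\: X| <= k.+1 * k.+1 + (k + k.+1).
Proof.
case/set0Pn => x xX.
have [/existsP[z /andP[zX /existsP[y /and3P[yW hzy ezy]]]]|no] :=
    boolP [exists z in X, exists y, [&& y \notin W, h z y & ~~ e z y]].
  exact: chunk_exit hzy ezy.
apply: leq_trans (chunk_noexit xX _) (leq_addl _ _) => z y zX yW.
apply/idP/idP; last exact: eh.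
move=> hzy; apply: contraNT no => ezy; apply/existsP; exists z.
by rewrite zX; apply/existsP; exists y; apply/and3P.
Qed.

End Chunk.
End Reduced.

(** * Recursion over the modules of the completion *)

Section Count.

Variables (T : finType) (e h : rel T) (k : nat).
Hypotheses (es : symmetric e) (ei : irreflexive e).
Hypotheses (hs : symmetric h) (hi : irreflexive h) (eh : subrel e h).
Hypotheses (ch : cographic h setT) (leF : #|added e h| <= k).
Hypothesis novertex : forall v, ~~ vertex_rule (enum T) e k v.
Hypothesis noedge : 0 < k -> forall x y, ~~ edge_rule (enum T) e k x y.

Let A : {set T} := ~: unaffected e h.
Let Q := (k.+1 * k.+1 + (k + k.+1)).+1.

Lemma card_affected : #|A| <= 2 * k.
Proof.
apply: (@leq_trans #|cover (added e h)|).
  apply: subset_leq_card; apply/subsetP => x; rewrite !inE negb_forall => /existsP[y hxy].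
  apply/bigcupP; exists [set x; y]; last by rewrite !inE eqxx.
  rewrite mem_added //; move: hxy; case exy: (e x y); case hxy: (h x y) => //.
  by rewrite eh in hxy.
apply: leq_trans (leq_card_cover _) _.
apply: (@leq_trans (\sum_(B in added e h) 2)).
  by apply: leq_sum => B /imsetP[[x y] _ ->]; rewrite cards2; case: (_ == _).
by rewrite sum_nat_const mulnC leq_mul2l leF.
Qed.

Lemma module_split (W X B : {set T}) op : module h W -> X \subset W -> module h X ->
  B \subset X -> (forall x y, x \in B -> y \in X :\: B -> h x y = op) -> module h B.
Proof.
move=> mW XW mX /subsetP BX opB x y z xB yB zB.
have [zX|zX] := boolP (z \in X); last by apply: mX => //; apply: BX.
by rewrite !(hs z) !opB // inE zB.
Qed.

(** A binary tree with [a] leaves has [2a - 1] nodes: if [a = a1 + a2] with both parts positive,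
    then [(2 a1 - 1) + (2 a2 - 1) + 1 = 2a - 1], the last unit being the vertices of [W] outside
    [X]. The successor in [Q] pays for the vertex that remains when [X] is a singleton. *)
Lemma module_card_bound (W : {set T}) : module h W -> 0 < #|W :&: A| ->
  #|W| <= (2 * #|W :&: A|).-1 * Q.
Proof.
move: {2}#|W| (leqnn #|W|) => n; elim: n W => [|n IH] W.
  by rewrite leqn0 cards_eq0 => /eqP->; rewrite cards0.
move=> leW mW A0.
pose P (X : {set T}) := [&& X \subset W, moduleb (enum T) h (mem X) & X :&: A == W :&: A].
have modE (X : {set T}) : moduleb (enum T) h (mem X) -> module h X.
  move/modulebP; have -> : [set x | mem X x] = X by apply/setP => x; rewrite inE.
  by [].
have modI (X : {set T}) : module h X -> moduleb (enum T) h (mem X).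
  move=> mX; apply/modulebP; have -> : [set x | mem X x] = X by apply/setP => x;
    rewrite inE.
  by [].
have PW : P W by rewrite /P subxx eqxx modI.
have [X /and3P[XW /modE mX /eqP XA] X_min] := @arg_minnP _ W P (fun X => #|X|) PW.
have X0 : X != set0.
  by apply: contraTneq A0 => X0; rewrite -XA X0 set0I cards0.
have WU : W :\: X \subset unaffected e h.
  apply/subsetP => u; rewrite inE => /andP[uX uW]; apply: contraNT uX => uA.
  have : u \in W :&: A by rewrite inE uW inE uA.
  by rewrite -XA inE => /andP[].
have leU := chunk_bound es ei hs hi eh ch leF novertex noedge mW mX XW WU X0.
have cardW : #|W| = #|X| + #|W :\: X|.
  by rewrite -(cardsID X W); congr (#|pred_of_set _| + _); apply/setIidPr.
have [X1|X1] := leqP #|X| 1.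
  apply: (@leq_trans Q); first by rewrite cardW /Q; lia.
  rewrite leq_pmull //; move: A0; clear; case: #|_| => // a _; lia.
have [B [op [B0 /properP[BX [w wX wB]] opB]]] := cograph_splittable hs hi
  (completion_cographic ch (D := X)) X1.
have mB := module_split mW XW mX BX opB.
have DX : X :\: B \subset X by apply: subsetDl.
have mD : module h (X :\: B).
  apply: (@module_split W X _ op mW XW mX DX) => x y xD; rewrite !inE negb_and negbK.
  by move=> /andP[/orP[yB|/negP yX] yX']; [rewrite hs opB | case: yX].
(* If [X :\: Y] had no affected vertex, [Y] would be a smaller module with the same affected
   vertices. So both parts of the split contain some, as the recursion requires. *)
have part (Y : {set T}) : Y \subset X -> module h Y -> 0 < #|X :\: Y| -> 0 < #|(X :\: Y)
  :&: A|.
  move=> YX mY XY; rewrite card_gt0; apply/negP => /eqP XYA.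
  have : P Y.
    rewrite /P (subset_trans YX XW) modI //= -XA eqEsubset setSI //=.
    apply/subsetP => a /setIP[aX aA]; rewrite inE aA andbT; apply: contraT => aY.
    have : a \in (X :\: Y) :&: A by rewrite inE aA inE aY aX.
    by rewrite XYA inE.
  move/X_min; rewrite -(cardsID Y X) leqNgt => /negP[].
  by move: (setIidPr YX) => ->; rewrite -addn1 leq_add2l.
have D0 : 0 < #|X :\: B| by rewrite card_gt0; apply/set0Pn; exists w; rewrite inE wB.
have DDB : X :\: (X :\: B) = B.
  by rewrite setDDr setDv set0U; apply/setIidPr.
have a2 : 0 < #|(X :\: B) :&: A| by apply: part.
have a1 : 0 < #|B :&: A|.
  by rewrite -{1}DDB; apply: part => //; rewrite DDB card_gt0.
have cX : #|X| = #|B| + #|X :\: B|.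
  by rewrite -(cardsID B X); congr (#|pred_of_set _| + _); apply/setIidPr.
have cA : #|W :&: A| = #|B :&: A| + #|(X :\: B) :&: A|.
  rewrite -XA -(cardsID B (X :&: A)) (setIAC X A B) (setIidPr BX).
  by rewrite setDE (setIAC X A) -setDE.
have B1 : 0 < #|B| by rewrite card_gt0.
have leX : #|X| <= n.+1 by apply: leq_trans leW; apply: subset_leq_card.
have leB : #|B| <= n by rewrite -ltnS; apply: leq_trans leX; rewrite cX -addn1 leq_add2l.
have leD : #|X :\: B| <= n.
  by rewrite -ltnS; apply: leq_trans leX; rewrite cX -add1n leq_add2r.
have := leq_add (leq_add (IH _ leB mB a1) (IH _ leD mD a2)) (leqW leU).
rewrite cardW cA cX; move: a1 a2; rewrite -/Q.
move: #|B :&: A| #|(X :\: B) :&: A| => [|a] [|b] // _ _.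
move=> le; apply: leq_trans le _.
by rewrite -mulnDl -mulSnr leq_mul2r; apply/orP; right; lia.
Qed.

(** With at most [2k] affected vertices the count is at most [4k * Q], where
    [Q = (k + 1) * (k + 3)]; the constant 13 leaves room. *)
Lemma reduced_bound : #|T| <= 13 * k.+1 ^ 3.
Proof.
have mT : module h setT by move=> x y z _ _; rewrite inE.
have [A0|A0] := posnP #|setT :&: A|.
  have : #|[set: T]| <= k.+1.
    apply: (small_unaffected_module es hs ch novertex mT).
    move/eqP: A0; rewrite cards_eq0 setTI => /eqP/setP A0.
    apply/subsetP => x _; have := A0 x; rewrite !inE => /negbFE.
    exact.
  rewrite cardsT => /leq_trans; apply; rewrite !expnS; nia.
have := module_card_bound mT A0; rewrite setTI cardsT => /leq_trans; apply.
apply: (@leq_trans ((2 * (2 * k)).-1 * Q)).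
  by rewrite leq_mul2r; apply/orP; right; have := card_affected; lia.
rewrite /Q !expnS; nia.
Qed.

End Count.

(** * Soundness of the rules *)

Lemma p4E (T : Type) (r : rel T) a b c d : symmetric r -> p4 r a b c d ->
  ((r a b = true) * (r b c = true) * (r c d = true) *
   (r b a = true) * (r c b = true) * (r d c = true)) *
  ((r a c = false) * (r b d = false) * (r a d = false) *
   (r c a = false) * (r d b = false) * (r d a = false)).
Proof.
move=> rs /and5P[ab bc cd /negbTE ac /andP[/negbTE bd /negbTE ad]].
by rewrite !(rs b a, rs c b, rs d c, rs c a, rs d b, rs d a).
Qed.

(** The path on four vertices is prime: two or three of its vertices are always distinguished by a
    remaining one. *)
Lemma p4_module (T : finType) (r : rel T) (M : {set T}) a b c d :
  symmetric r -> module r M -> p4 r a b c d ->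
  (a \in M) + (b \in M) + (c \in M) + (d \in M) \in [:: 0; 1; 4].
Proof.
move=> rs mM P; have E := p4E rs P; move: mM; clear P => mM.
have F x y z : x \in M -> y \in M -> z \notin M -> r z x = ~~ r z y -> False.
  by move=> xM yM zM; rewrite (mM x y z) //; case: (r z y).
case: (boolP (a \in M)) => aM; case: (boolP (b \in M)) => bM;
  case: (boolP (c \in M)) => cM; case: (boolP (d \in M)) => dM //; exfalso.
all: first [ by apply: (F a b c); rewrite ?E | by apply: (F a b d); rewrite ?E
  | by apply: (F a c b); rewrite ?E | by apply: (F a c d); rewrite ?E
  | by apply: (F a d b); rewrite ?E | by apply: (F a d c); rewrite ?E
  | by apply: (F b c a); rewrite ?E | by apply: (F b c d); rewrite ?E
  | by apply: (F b d a); rewrite ?E | by apply: (F b d c); rewrite ?E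
  | by apply: (F c d a); rewrite ?E | by apply: (F c d b); rewrite ?E ].
Qed.

(** The path on four vertices and its complement are both connected, so it cannot cross a disjoint
    union or a join. *)
Lemma p4_cut (T : finType) (r : rel T) (C M : {set T}) (op : bool) a b c d :
  symmetric r -> (forall x y, x \in C -> y \in M :\: C -> r x y = op) -> p4 r a b c d ->
  a \in M -> b \in M -> c \in M -> d \in M ->
  [&& a \in C, b \in C, c \in C & d \in C] ||
  [&& a \in M :\: C, b \in M :\: C, c \in M :\: C & d \in M :\: C].
Proof.
move=> rs opC P aM bM cM dM; have E := p4E rs P; rewrite !inE aM bM cM dM !andbT.
have F x y : x \in C -> y \notin C -> y \in M -> r x y = ~~ op -> False.
  by move=> xC yC yM; rewrite opC ?inE ?yC //; case: (op).
clear P; case: op opC F => opC F;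
case: (boolP (a \in C)) => aC; case: (boolP (b \in C)) => bC;
  case: (boolP (c \in C)) => cC; case: (boolP (d \in C)) => dC //; exfalso.
all: first [ by apply: (F a b); rewrite ?E | by apply: (F b a); rewrite ?E
  | by apply: (F a c); rewrite ?E | by apply: (F c a); rewrite ?E
  | by apply: (F a d); rewrite ?E | by apply: (F d a); rewrite ?E
  | by apply: (F b c); rewrite ?E | by apply: (F c b); rewrite ?E
  | by apply: (F b d); rewrite ?E | by apply: (F d b); rewrite ?E
  | by apply: (F c d); rewrite ?E | by apply: (F d c); rewrite ?E ].
Qed.

Section Reinsert.

Variables (T : finType) (e h : rel T) (k : nat) (v : T) (M C : {set T}) (op : bool).
Hypotheses (es : symmetric e) (ei : irreflexive e).
Hypotheses (hs : symmetric h) (hi : irreflexive h).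
Hypothesis eh : forall x y, x != v -> y != v -> e x y -> h x y.
Hypotheses (ch : cographic h [set~ v]) (leF : #|added e h| <= k).
Hypotheses (mM : module e M) (vC : v \in C) (CM : C \subset M) (ltM : k.+1 < #|M|).
Hypotheses (cC : cographic e C) (opC : forall x y, x \in C -> y \in M :\: C -> e x y = op).

(** Otherwise each of the at least [k + 1] vertices [w] of [M :\ v] has an added edge to some [f w]
    outside [M]; these edges are distinct because each has only one end in [M]. *)
Lemma unaffected_representative : exists2 w, w \in M :\ v &
  forall y, y \notin M -> h w y = e w y.
Proof.
have [/existsP[w /andP[wM /forall_inP H]]|no] :=
    boolP [exists w in M :\ v, [forall y in ~: M, h w y == e w y]].
  by exists w => // y yM; apply/eqP/H; rewrite inE.
have vM := subsetP CM _ vC.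
pose P w y := [&& y \notin M, h w y & ~~ e w y].
pose f w := odflt w [pick y | P w y].
have fP w : w \in M :\ v -> P w (f w).
  move=> wM; rewrite /f; case: pickP => //= P0; case/negP: no; apply/existsP; exists w.
  rewrite wM; apply/forall_inP => y; rewrite inE => yM; have := P0 y; rewrite /P yM /=.
  move: wM; rewrite inE => /andP[]; rewrite inE => wv wM.
  have yv : y != v by apply: contraNneq yM => ->.
  by have := @eh w y wv yv; case: (e w y); case: (h w y) => //= ->.
have f_inj : {in M :\ v &, injective (fun w => [set w; f w])}.
  move=> w w' wM w'M E; have /and3P[_ _ _] := fP w wM.
  have /and3P[fM _ _] := fP w' w'M.
  have : w \in [set w'; f w'] by rewrite -E !inE eqxx.
  rewrite in_set2 => /orP[/eqP//|/eqP wE]; move: fM; rewrite -wE.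
  by move: wM; rewrite inE => /andP[_ ->].
have : #|M :\ v| <= #|added e h|.
  rewrite -(card_in_imset f_inj); apply: subset_leq_card.
  apply/subsetP => _ /imsetP[w /fP/and3P[_ h1 h2] ->]; rewrite mem_added //.
  by rewrite h1.
move=> le; have := leq_trans le leF; rewrite leqNgt.
by rewrite -ltnS; move: ltM; rewrite (cardsD1 v) vM add1n => /= ->.
Qed.

(** A path of the new relation has none, one or all of its vertices in [M]. In the first two cases,
    moving its vertex in [M] to [w] gives a path of [h] avoiding [v]; in the last it lies inside [C]
    or inside [M :\: C]. *)
Lemma reinsert : completable e k.
Proof.
have [w wM wE] := unaffected_representative.
have vM := subsetP CM _ vC.
pose keep x y := (x \notin M) && (y \notin M) || (x \in M :\: C) && (y \in M :\: C).
(* [h] is kept outside [M] and inside [M :\: C]; everything else is reset to [e], with which [h]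
   already agrees between [w] and the outside of [M]. *)
pose h2 x y := if keep x y then h x y else e x y.
have keepv x y : keep x y -> x != v /\ y != v.
  case/orP => /andP[xK yK]; split.
  - by apply: contraNneq xK => ->.
  - by apply: contraNneq yK => ->.
  - by apply: contraTneq xK => ->; rewrite inE vC.
  - by apply: contraTneq yK => ->; rewrite inE vC.
have keepC x y : keep x y = keep y x by rewrite /keep andbC (andbC (x \in _)).
have h2s : symmetric h2 by move=> x y; rewrite /h2 keepC hs es.
have h2out x y : x \notin M -> y \in M -> h2 x y = e x y.
  by move=> xM yM; rewrite /h2 /keep yM andbF !inE (negbTE xM) andbF.
have mM2 : module h2 M by move=> x y z xM yM zM; rewrite !h2out //; apply: mM.
have opC2 x y : x \in C -> y \in M :\: C -> h2 x y = op.
  move=> xC yM; rewrite -(opC xC yM) /h2 /keep (subsetP CM _ xC) /=.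
  by rewrite !inE xC.
pose r z := if z \in M then w else z.
have /andP[wv w_in] : (w != v) && (w \in M) by move: wM; rewrite inE => /andP[];
  rewrite inE => ->.
have rv z : r z \in [set~ v].
  rewrite !inE /r; case: ifP => // zM; apply: contraFneq zM => ->; exact: vM.
have R x y : ~~ ((x \in M) && (y \in M)) -> h2 x y = h (r x) (r y).
  rewrite /r; case: (boolP (x \in M)) => xM; case: (boolP (y \in M)) => yM // _.
  - by rewrite h2s h2out // (mM xM w_in) // es -wE.
  - by rewrite h2out // (mM yM w_in) // es -wE // hs.
  - by rewrite /h2 /keep xM yM.
have P4r a b c d : (a \in M) + (b \in M) + (c \in M) + (d \in M) <= 1 ->
    p4 h2 a b c d = p4 h (r a) (r b) (r c) (r d).
  move=> le1; rewrite /p4 !R //; move: le1;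
  by case: (a \in M); case: (b \in M); case: (c \in M); case: (d \in M).
exists h2; split=> //.
- by move=> x; rewrite /h2 ei hi; case: ifP.
- move=> x y exy; rewrite /h2; case: ifP => // /keepv[xv yv]; exact: eh.
- move=> a b c d _ _ _ _; apply/negP => P.
  have := p4_module h2s mM2 P; rewrite !inE => H.
  have [/eqP H4|H1] := boolP ((a \in M) + (b \in M) + (c \in M) + (d \in M) == 4);
    last first.
    move: P; rewrite P4r; first by apply/negP; apply: ch.
    by case/or3P: H H1 => /eqP->.
  have : [&& a \in M, b \in M, c \in M & d \in M].
    by move: H4; case: (a \in M); case: (b \in M); case: (c \in M); case: (d \in M).
  case/and4P => aM bM cM dM.
  case/orP: (p4_cut h2s opC2 P aM bM cM dM) => /and4P[aC bC cC' dC].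
    have := cC aC bC cC' dC; move: P; rewrite /p4.
    have E x y : x \in C -> y \in C -> h2 x y = e x y.
      by move=> xC yC; rewrite /h2 /keep !inE (subsetP CM _ xC) xC.
    by rewrite !E // => ->.
  have V x : x \in M :\: C -> x \in [set~ v].
    by rewrite !inE => /andP[+ _]; apply: contraNneq => ->.
  have := ch (V _ aC) (V _ bC) (V _ cC') (V _ dC); move: P; rewrite /p4.
  have E x y : x \in M :\: C -> y \in M :\: C -> h2 x y = h x y.
    by move=> xC yC; rewrite /h2 /keep xC yC orbT.
  by rewrite !E // => ->.
- apply: leq_trans leF; apply: subset_leq_card; apply/subsetP => B /imsetP[[x y]].
  rewrite inE /= => /andP[h2xy exy] ->; rewrite mem_added // exy andbT.
  by move: h2xy; rewrite /h2; case: ifP => //; rewrite (negbTE exy).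
Qed.

End Reinsert.

Lemma vertex_rule_module (T : finType) (e : rel T) k v :
  symmetric e -> irreflexive e -> vertex_rule (enum T) e k v ->
  exists (M C : {set T}) (op : bool), [/\ module e M, v \in C & C \subset M] /\
    [/\ k.+1 < #|M|, cographic e C & forall x y, x \in C -> y \in M :\: C -> e x y = op].
Proof.
move=> es ei; have core_in u : v \in core_set e u v.
  by apply/core_setP; split; [apply: closure2_r | exists v; rewrite closure2_r ei].
have core_in' u : v \in core_set (compl e) u v.
  apply/core_setP; split; [apply: closure2_r | exists v].
  by rewrite closure2_r (compl_irr e).
have core_sub (r : rel T) u : core_set r u v \subset closure2 r u v.
  by apply/subsetP => w /core_setP[].
case/or3P; last first.
- case/chain_ruleP => u [mM ltM cC opC];
  exists (closure2 (compl e) u v), (core_set (compl e) u v), false.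
  split; split=> //; [exact/(module_compl_iff _ ei) | exact/(cographic_compl_iff _ es ei)
    |].
  by move=> x y xC yM; have /andP[_ /negbTE] := opC x y xC yM.
- case/chain_ruleP => u [mM ltM cC opC].
  by exists (closure2 e u v), (core_set e u v), true.
rewrite /twin_rule count_enum => ltM.
pose tw := [set u | twin (enum T) e v u].
have twP u : u \in tw -> module e (closure2 e u v) /\ cographic e (closure2 e u v).
  by rewrite inE => /andP[/modulebP ? /cographbP].
pose M := \bigcup_(u in tw) closure2 e u v.
have twM : tw \subset M.
  by apply/subsetP => u uT; apply/bigcupP; exists u; rewrite ?closure2_l.
have /set0Pn[u uT] : tw != set0 by rewrite -card_gt0; apply: leq_trans ltM.
(* On a path [a b c d], the closures containing [b] and [c] cannot contain [a], since a cographic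
   module meets the path in at most one vertex. So [a] sees [b] and [c] as it sees [v], although it
   is adjacent to [b] and not to [c]. *)
have cM : cographic e M.
  move=> a b c d _ /bigcupP[ub /twP[mb cb] bM] /bigcupP[uc /twP[mc cc] cM] _.
  apply/negP => P; have E := p4E es P.
  have out (D : {set T}) : module e D -> cographic e D -> (b \in D) || (c \in D) -> a
    \notin D.
    move=> mD cD bcD; have := p4_module es mD P; apply: contraL => aD.
    rewrite !inE; have := cD a b c d; rewrite P aD.
    by move: bcD; case: (b \in D); case: (c \in D);
      case: (d \in D) => //= _ /(_ isT isT isT isT).
  have ab := mb _ _ _ bM (closure2_r e ub v) (out _ mb cb (introT orP (or_introl bM))).
  have ac := mc _ _ _ cM (closure2_r e uc v) (out _ mc cc (introT orP (or_intror cM))).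
  by move: ab; rewrite -ac !E.
exists M, M, true; split; split=> //.
- move=> x y z /bigcupP[ux uxT xM] /bigcupP[uy uyT yM] zM.
  have [mx _] := twP _ uxT; have [my _] := twP _ uyT.
  rewrite (mx x v z) ?closure2_r //; last by apply: contra zM => zx; apply/bigcupP;
    exists ux.
  by rewrite (my y v z) ?closure2_r //; apply: contra zM => zx; apply/bigcupP; exists uy.
- by apply/bigcupP; exists u; rewrite ?closure2_r.
- by apply: leq_trans ltM _; apply: subset_leq_card.
- by move=> x y _; rewrite setDv inE.
Qed.

Lemma card_added_map (T T' : finType) (f : T' -> T) (e h : rel T) : injective f ->
  #|added (fun a b => e (f a) (f b)) (fun a b => h (f a) (f b))| <= #|added e h|.
Proof.
move=> fI; rewrite -(card_imset _ (@imset_inj _ _ f fI)); apply: subset_leq_card.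
apply/subsetP => _ /imsetP[_ /imsetP[[x y] /= xy ->] ->].
rewrite imsetU1 imset_set1; apply/imsetP; exists (f x, f y) => //.
by move: xy; rewrite !inE.
Qed.

Section DeleteVertex.

Variables (T T' : finType) (f : T' -> T) (v : T) (e : rel T) (k : nat).
Hypotheses (fI : injective f) (fv : forall a, f a != v).
Hypothesis f_onto : forall x, x != v -> exists a, x = f a.
Hypotheses (es : symmetric e) (ei : irreflexive e).
Let e' : rel T' := fun a b => e (f a) (f b).

Lemma completable_restrict : completable e k -> completable e' k.
Proof.
case=> h [hs hi eh ch leF]; exists (fun a b => h (f a) (f b)); split=> //.
- by move=> a b /= /eh.
- by move=> a b c d _ _ _ _; apply: (ch (f a) (f b) (f c) (f d)); rewrite inE.
- exact: leq_trans (card_added_map _ _ fI) leF.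
Qed.

Lemma vertex_rule_sound : vertex_rule (enum T) e k v ->
  completable e' k -> completable e k.
Proof.
move/(vertex_rule_module es ei) => [M [C [op [[mM vC CM] [ltM cC opC]]]]].
case=> h' [hs hi eh ch leF].
pose h x y := [exists a, exists b, [&& f a == x, f b == y & h' a b]].
have hE a b : h (f a) (f b) = h' a b.
  apply/existsP/idP => [[a' /existsP[b' /and3P[/eqP/fI-> /eqP/fI->]]]//|hab].
  by exists a; apply/existsP; exists b; rewrite !eqxx.
have hP x y : h x y -> exists a b, [/\ x = f a, y = f b & h' a b].
  by case/existsP => a /existsP[b /and3P[/eqP<- /eqP<- ?]]; exists a, b.
have hs2 : symmetric h.
  by move=> x y; apply/idP/idP => /hP[a [b [-> -> hab]]]; rewrite hE hs.
apply: (@reinsert T e h k v M C op) => //.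
- move=> x; apply/negbTE/negP => /hP[a [b [xa xb hab]]].
  by move: hab; rewrite (fI (etrans (esym xa) xb)) hi.
- by move=> _ _ /f_onto[a ->] /f_onto[b ->]; rewrite hE; apply: eh.
- move=> x y z t; rewrite !inE => /f_onto[a ->] /f_onto[b ->] /f_onto[c ->] /f_onto[d ->].
  by have := ch a b c d; rewrite /p4 !hE; apply; rewrite inE.
- apply: leq_trans leF; rewrite -(card_imset _ (@imset_inj _ _ f fI)).
  apply: subset_leq_card; apply/subsetP => B /imsetP[[x y]].
  rewrite inE /= => /andP[/hP[a [b [-> -> hab]]] eab] ->.
  apply/imsetP; exists [set a; b]; last by rewrite imsetU1 imset_set1.
  by apply/imsetP; exists (a, b); rewrite // inE /= hab.
Qed.

End DeleteVertex.

(** * Forced edges *)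

Definition add_edge (T : eqType) (e : rel T) (x y : T) : rel T :=
  fun z w => [|| e z w, (z == x) && (w == y) | (z == y) && (w == x)].

Section AddEdge.

Variables (T : finType) (e : rel T) (k : nat) (x y : T).
Hypotheses (es : symmetric e) (ei : irreflexive e).
Hypothesis rule : edge_rule (enum T) e k x y.

Lemma edge_rule_neq : x != y /\ ~~ e x y.
Proof.
case/has_enumP: rule => s; rewrite count_enum => ltP.
have /card_gt0P[p] : 0 < #|[set p | p4 e x s y p]| by apply: leq_trans ltP.
rewrite inE => /and5P[xs sy yp xy /andP[sp xp]]; split=> //.
by apply: contraNneq xp => ->.
Qed.

Lemma add_edge_sym : symmetric (add_edge e x y).
Proof. by move=> z w; rewrite /add_edge es; congr (_ || _);
  rewrite orbC andbC (andbC (z == x)). Qed.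

Lemma add_edge_irr : irreflexive (add_edge e x y).
Proof.
have [xy _] := edge_rule_neq.
move=> z; rewrite /add_edge ei /=; case: (eqVneq z x) => [->|] /=.
  by rewrite (negbTE xy).
by rewrite andbF.
Qed.

Lemma edge_rule_forced h : symmetric h -> irreflexive h -> subrel e h ->
  cographic h setT -> #|added e h| <= k -> h x y.
Proof.
move=> hs hi eh ch leF; apply: contraT => hxy.
case/has_enumP: rule => s; rewrite count_enum => ltP.
pose f p := if h x p then [set x; p] else [set s; p].
have fP p : p4 e x s y p -> f p \in added e h.
  case/and5P => xs sy yp xy /andP[sp xp]; rewrite /f; case: ifP => hxp.
    by rewrite mem_added // hxp xp.
  rewrite mem_added // sp andbT; apply: contraT => hsp.
  have := ch x s y p; rewrite /p4 (eh _ _ xs) (eh _ _ sy) (eh _ _ yp) hxy hsp hxp /=.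
  by rewrite !inE => /(_ isT isT isT isT).
have fI : {in [set p | p4 e x s y p] &, injective f}.
  have N p : p4 e x s y p -> p != x /\ p != s.
    case/and5P => xs sy yp xy /andP[sp xp]; split.
      by apply: contraNneq xy => px; rewrite es -px.
    by apply: contraNneq xp => ->.
  have pf p : p \in f p by rewrite /f; case: ifP; rewrite !inE eqxx orbT.
  move=> p q; rewrite !inE => /N[px ps] _ E; have := pf p; rewrite E /f.
  by case: ifP => _; rewrite !inE ?(negbTE px) ?(negbTE ps) => /eqP.
have : #|[set p | p4 e x s y p]| <= #|added e h|.
  rewrite -(card_in_imset fI); apply: subset_leq_card.
  by apply/subsetP => _ /imsetP[p + ->]; rewrite inE => /fP.
by move/leq_trans/(_ leF); rewrite leqNgt ltP.
Qed.

Lemma edge_rule_sound : 0 < k -> completable e k <-> completable (add_edge e x y) k.-1.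
Proof.
move=> k0; have [xy exy] := edge_rule_neq.
have as_ := add_edge_sym; have ai := add_edge_irr.
split=> -[h [hs hi eh ch leF]]; exists h; split=> //.
- move=> z w /or3P[/eh //||] /andP[/eqP-> /eqP->]; rewrite ?[h y x]hs;
  exact: edge_rule_forced.
- have hxy := edge_rule_forced hs hi eh ch leF.
  rewrite -ltnS prednK //; apply: leq_trans leF; apply: proper_card; apply/properP; split.
    apply/subsetP => B /imsetP[[z w]]; rewrite inE /= => /andP[hzw azw] ->.
    by rewrite mem_added // hzw; apply: contra azw => ezw; rewrite /add_edge ezw.
  exists [set x; y]; rewrite mem_added // ?hxy ?exy //.
  by rewrite /add_edge !eqxx orbT.
- by move=> z w ezw; apply: eh; rewrite /add_edge ezw.
- rewrite -(prednK k0); apply: (@leq_trans #|[set x; y] |: added (add_edge e x y) h|).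
    apply: subset_leq_card; apply/subsetP => B /imsetP[[z w]];
      rewrite inE /= => /andP[hzw ezw] ->.
    rewrite in_setU1; case: eqVneq => //= ne;
      rewrite mem_added // hzw /add_edge negb_or ezw /=.
    by apply: contra ne => /orP[] /andP[/eqP-> /eqP->]; rewrite // setUC.
  by rewrite cardsU1; case: (_ \notin _); rewrite ?add1n ?add0n // leqW.
Qed.

End AddEdge.

(** * From edge sets to adjacency relations *)

Lemma cograph_cographic (T : finType) (E : {set {set T}}) :
  (forall x, [set x] \notin E) -> cograph E <-> cographic (adj E) setT.
Proof.
move=> irrE; have as_ : symmetric (adj E) by move=> x y; rewrite /adj setUC.
have ai : irreflexive (adj E) by move=> x; rewrite /adj setUid (negbTE (irrE x)).
split=> [cE a b c d _ _ _ _|cE [f [fI fP]]].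
  apply/negP => P; have Q := p4E as_ P; have [nac nbd nad] := p4_neq as_ P; apply: cE.
  pose s := [:: a; b; c; d].
  exists (fun i : 'I_4 => nth a s i).
  have adjE (i j : 'I_4) : adj E (nth a s i) (nth a s j) = P4 i j.
    by case: i => [[|[|[|[]]]]] //= ?; case: j => [[|[|[|[]]]]] //= ?; rewrite ?Q ?ai.
  split=> // i j ij; apply/val_inj/eqP.
  have ne x y : adj E x y -> x != y by apply: contraTneq => ->; rewrite ai.
  have us : uniq s by rewrite /= !inE !negb_or nac nad nbd !ne ?Q.
  by rewrite -(@nth_uniq _ a s i j (ltn_ord i) (ltn_ord j) us) ij.
pose g k : 'I_4 := inord k.
have := cE (f (g 0)) (f (g 1)) (f (g 2)) (f (g 3)).
by rewrite /p4 !fP /P4 !inordK // !inE => /(_ isT isT isT isT).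
Qed.

Lemma cograph_completion_completable (G : graph) k :
  cograph_completion G k <-> completable (adj (edges G)) k.
Proof.
set E := edges G.
have as_ F : symmetric (@adj 'I_(nvert G) F) by move=> x y; rewrite /adj setUC.
have irr (F : {set {set 'I_(nvert G)}}) : (forall e, e \in F -> #|e| = 2) ->
    forall x, [set x] \notin F.
  by move=> F2 x; apply/negP => /F2; rewrite cards1.
have Eirr := irr _ (@edgesP G).
split=> [[F [F2 disj leF cF]]|[h [hs hi eh ch leF]]].
  have EF2 x : [set x] \notin E :|: F by rewrite inE negb_or Eirr (irr F).
  exists (adj (E :|: F)); split=> //.
  - by move=> x; rewrite /adj setUid (negbTE (EF2 x)).
  - by move=> x y; rewrite /adj inE => ->.
  - exact/(cograph_cographic EF2).
  - apply: leq_trans leF; apply: subset_leq_card; apply/subsetP => B /imsetP[[x y]].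
    by rewrite inE /= => /andP[]; rewrite /adj inE => /orP[->//|xyF] _ ->.
have F2 B : B \in added (adj E) h -> #|B| = 2.
  case/imsetP => -[x y]; rewrite inE /= => /andP[hxy _] ->; rewrite cards2.
  by case: eqVneq hxy => // ->; rewrite hi.
exists (added (adj E) h); split=> //.
  rewrite -setI_eq0; apply/eqP/setP => B; rewrite in_set0 in_setI; apply/negP => /andP[].
  by case/imsetP => -[x y]; rewrite inE /= /adj => /andP[_ /negbTE exy] ->; rewrite exy.
apply/cograph_cographic.
  by move=> x; rewrite inE negb_or Eirr (irr _ F2).
apply: eq_cographic ch => x y _ _.
have -> : adj (E :|: added (adj E) h) x y = adj E x y || ([set x; y] \in added (adj E) h).
  by rewrite /adj inE.
by rewrite mem_added //; have := eh x y; case: (adj E x y) => [->|] //; rewrite andbT.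
Qed.

(** * Programs for the rules *)

Lemma realizable_drop j f : realizable f ->
  realizable (fun L m v => f L m (iter j behead v)).
Proof.
move=> rf g d d0 gd.
have gd' : all (fun r => r < d) (iter j behead g).
  by elim: j => //= j /allP IH; apply/allP => r /mem_behead/IH.
have [p [D H]] := rf (iter j behead g) d d0 gd'.
exists p, D => L m s /H[t [s' [h1 h2 h3 h4 h5]]]; exists t, s'; split=> //.
by rewrite h4; congr (f L m _); elim: j {gd' H h4} => //= j <-; rewrite behead_map.
Qed.

Lemma realizable_var_drop j : realizable (fun _ _ v => nth 0 (iter j behead v) 0).
Proof. exact: (realizable_drop j (realizable_var 0)). Qed.

(** Substitution of a computed value for the innermost variable of [f]; [j] is the number of
    variables in scope at the call that [f] does not know and that are dropped from its
    environment. *)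
Lemma realizable_let j (f : nat -> (nat -> nat) -> nat -> seq nat -> nat) h :
  realizable (fun L m v => f L m (nth 0 v 0) (behead v)) -> realizable h ->
  realizable (fun L m v => f L m (h L m v) (iter j behead v)).
Proof.
move=> rf rh g d d0 gd; have [p1 [D1 H1]] := rh g d d0 gd.
have gd' : all (fun r => r < d.+1) (d :: iter j behead g).
  rewrite /= ltnSn /=; apply/allP => r rg; apply: ltnW; apply: (allP gd).
  by elim: j r rg => //= j IH r /mem_behead/IH.
have [p2 [D2 H2]] := rf (d :: iter j behead g) d.+1 isT gd'.
exists (Seq p1 (Seq p2 (Assign d (Reg d.+1)))), (D1 + (D2 + 1).+1).+1 => L m s R.
have [t1 [s1 [e1 m1 r1 v1 le1]]] := H1 _ _ _ R.
have [|t2 [s2 [e2 m2 r2 v2 le2]]] := H2 L m s1; first by apply: rep_eqmem R; rewrite ?r1.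
exists (t1 + (t2 + 1)); eexists; split.
- by apply: ExecSeq e1 _; apply: ExecSeq e2 _; apply: ExecAssign.
- by rewrite /= m2.
- by move=> r rd; rewrite /= updateE ltn_eqF // r2 ?r1 // ltnW.
- rewrite /= updateE eqxx /= v2 /= v1; congr (f L m _ _).
  rewrite -(map_regs gd r1); elim: j {gd' H2 v2 e2 m2 r2 rf} => //= j <-.
  by rewrite behead_map.
- by apply: leq_powD le1 _; apply: leq_powD le2 _; apply: leq_powc.
Qed.

Definition decidable (b : nat -> (nat -> nat) -> seq nat -> bool) : Prop :=
  realizable (fun L m v => b L m v).

Lemma decidable_let j (P : nat -> (nat -> nat) -> nat -> seq nat -> bool) h :
  decidable (fun L m v => P L m (nth 0 v 0) (behead v)) -> realizable h ->
  decidable (fun L m v => P L m (h L m v) (iter j behead v)).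
Proof. exact: (@realizable_let j (fun L m x v => P L m x v)). Qed.

Lemma decidable_leq f1 f2 : realizable f1 -> realizable f2 ->
  decidable (fun L m v => f1 L m v <= f2 L m v).
Proof.
move=> r1 r2; apply: (@realizable_ext (fun L m v => 1 - (f1 L m v - f2 L m v))).
  by move=> L m v; rewrite -subn_eq0; case: (f1 L m v - f2 L m v).
by apply: realizable_sub; [apply: realizable_const | apply: realizable_sub].
Qed.

Lemma decidable_neg b : decidable b -> decidable (fun L m v => ~~ b L m v).
Proof.
move=> r; apply: (@realizable_ext (fun L m v => 1 - b L m v)).
  by move=> L m v; case: (b L m v).
by apply: realizable_sub => //; apply: realizable_const.
Qed.

Lemma decidable_and b1 b2 : decidable b1 -> decidable b2 ->
  decidable (fun L m v => b1 L m v && b2 L m v).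
Proof.
move=> r1 r2; apply: (@realizable_ext (fun L m v => if b1 L m v then b2 L m v : nat else
  0)).
  by move=> L m v; case: (b1 L m v).
by apply: realizable_if => //; apply: realizable_const.
Qed.

Lemma decidable_or b1 b2 : decidable b1 -> decidable b2 ->
  decidable (fun L m v => b1 L m v || b2 L m v).
Proof.
move=> r1 r2; apply: (@realizable_ext (fun L m v => if b1 L m v then 1 else b2 L m v :
  nat)).
  by move=> L m v; case: (b1 L m v).
by apply: realizable_if => //; apply: realizable_const.
Qed.

Lemma decidable_eqn (f1 f2 : tabfun) : realizable f1 -> realizable f2 ->
  decidable (fun L m v => f1 L m v == f2 L m v).
Proof.
move=> r1 r2.
apply: (@realizable_ext (fun L m v => (f1 L m v <= f2 L m v) && (f2 L m v <= f1 L m v))).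
  by move=> L m v; rewrite -eqn_leq.
exact: (decidable_and (decidable_leq r1 r2) (decidable_leq r2 r1)).
Qed.

Lemma decidable_eqb b1 b2 : decidable b1 -> decidable b2 ->
  decidable (fun L m v => b1 L m v == b2 L m v).
Proof.
move=> r1 r2; apply: (@realizable_ext (fun L m v => nat_of_bool (b1 L m v == b2 L m v :>
  nat))).
  by move=> L m v; case: (b1 L m v); case: (b2 L m v).
exact: (decidable_eqn r1 r2).
Qed.

Lemma realizable_count_iota (P : nat -> (nat -> nat) -> nat -> seq nat -> bool) :
  decidable (fun L m v => P L m (nth 0 v 0) (behead v)) ->
  realizable (fun L m v => count (fun x => P L m x v) (iota 0 L)).
Proof.
move=> rP; apply: (@realizable_ext (fun L m v => \sum_(i < L) P L m i v)).
  move=> L m v; rewrite -(big_mkord xpredT (fun i => nat_of_bool (P L m i v))).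
  by rewrite -sumn_count /index_iota subn0 sumnE big_map.
exact: (@realizable_sum (fun L m x v => P L m x v)).
Qed.

Lemma decidable_has_iota (P : nat -> (nat -> nat) -> nat -> seq nat -> bool) :
  decidable (fun L m v => P L m (nth 0 v 0) (behead v)) ->
  decidable (fun L m v => has (fun x => P L m x v) (iota 0 L)).
Proof.
move=> rP; apply: (@realizable_ext (fun L m v =>
    nat_of_bool (0 < count (fun x => P L m x v) (iota 0 L)))).
  by move=> L m v; rewrite -has_count.
exact: (decidable_leq (realizable_const 1) (realizable_count_iota rP)).
Qed.

(** The least index is obtained by counting: it is the number of [i] such that no [j <= i] satisfies
    the predicate. This also gives [L] when the search fails. *)
Lemma realizable_find (P : nat -> (nat -> nat) -> nat -> seq nat -> bool) :
  decidable (fun L m v => P L m (nth 0 v 0) (behead v)) ->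
  realizable (fun L m v => find (fun x => P L m x v) (iota 0 L)).
Proof.
move=> rP; apply: (@realizable_ext (fun L m v =>
    count (fun i => ~~ has (fun j => (j <= i) && P L m j v) (iota 0 L)) (iota 0 L))).
  move=> L m v; set F := find _ _.
  have FL : F <= L by rewrite -[X in _ <= X](size_iota 0 L) find_size.
  rewrite (@eq_in_count _ _ (fun i => i < F)); last first.
    move=> i; rewrite mem_iota add0n => /andP[_ iL]; rewrite ltnNge; congr (~~ _).
    apply/hasP/idP => [[j + /andP[ji Pj]]|Fi].
      rewrite mem_iota add0n => /andP[_ jL]; apply: leq_trans ji; rewrite leqNgt.
      apply/negP => /(before_find 0); rewrite nth_iota // add0n => jP; by rewrite jP in Pj.
    have FL' : F < L by apply: leq_ltn_trans iL.
    exists F; first by rewrite mem_iota.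
    have : has (fun x => P L m x v) (iota 0 L) by rewrite has_find size_iota.
    by move/(nth_find 0); rewrite nth_iota // add0n Fi => ->.
  rewrite -{1}(subnKC FL) iotaD count_cat.
  rewrite (@eq_in_count _ _ predT) ?count_predT ?size_iota; last first.
    by move=> i; rewrite mem_iota add0n => /andP[_ ->].
  rewrite (@eq_in_count _ _ pred0) ?count_pred0 ?addn0 // => i.
  by rewrite mem_iota add0n => /andP[Fi _]; rewrite ltnNge Fi.
apply: (@realizable_count_iota (fun L m i v => ~~ has (fun j => (j <= i) && P L m j v)
  (iota 0 L))).
apply: decidable_neg.
apply: (@decidable_has_iota (fun L m j v => (j <= nth 0 v 0) && P L m j (behead v))).
apply: decidable_and.
  by apply: decidable_leq; [apply: (realizable_var_drop 0) | apply: (realizable_var_drop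
    1)].
exact: (@decidable_let 2 P _ rP (realizable_var_drop 0)).
Qed.

(* The detour through [L] makes a search among the [m 1] vertices a loop of
   length [L], which does not depend on the table. *)
Definition vertices (L : nat) (m : nat -> nat) : seq nat :=
  [seq i <- iota 0 L | i < m 1].

Lemma decidable_has (P : nat -> (nat -> nat) -> nat -> seq nat -> bool) :
  decidable (fun L m v => P L m (nth 0 v 0) (behead v)) ->
  decidable (fun L m v => has (fun x => P L m x v) (vertices L m)).
Proof.
move=> rP; apply: (@realizable_ext (fun L m v =>
    nat_of_bool (has (fun x => (x < m 1) && P L m x v) (iota 0 L)))).
  by move=> L m v; rewrite !has_count count_filter; congr (nat_of_bool (0 < _));
     apply: eq_count => x /=; rewrite andbC.
apply: (@decidable_has_iota (fun L m x v => (x < m 1) && P L m x v)).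
apply: decidable_and => //; apply: decidable_leq.
  by apply: realizable_add (realizable_const 1) (realizable_var_drop 0).
by apply: realizable_read; apply: realizable_const.
Qed.

Lemma realizable_count (P : nat -> (nat -> nat) -> nat -> seq nat -> bool) :
  decidable (fun L m v => P L m (nth 0 v 0) (behead v)) ->
  realizable (fun L m v => count (fun x => P L m x v) (vertices L m)).
Proof.
move=> rP; apply: (@realizable_ext (fun L m v =>
    count (fun x => (x < m 1) && P L m x v) (iota 0 L))).
  by move=> L m v; rewrite count_filter; apply: eq_count => x /=; rewrite andbC.
apply: (@realizable_count_iota (fun L m x v => (x < m 1) && P L m x v)).
apply: decidable_and => //; apply: decidable_leq.
  by apply: realizable_add (realizable_const 1) (realizable_var_drop 0).
by apply: realizable_read; apply: realizable_const.
Qed.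

Definition decidable_rel (e : nat -> (nat -> nat) -> rel nat) : Prop :=
  forall f g, realizable f -> realizable g ->
  decidable (fun L m v => e L m (f L m v) (g L m v)).

Lemma decidable_compl e : decidable_rel e -> decidable_rel (fun L m => compl (e L m)).
Proof.
move=> re f g rf rg; apply: decidable_and; first by apply: decidable_neg;
  apply: decidable_eqn.
by apply: decidable_neg; apply: re.
Qed.

Section RealizeRules.

Variable e : nat -> (nat -> nat) -> rel nat.
Hypothesis re : decidable_rel e.

Lemma decidable_split1 f g h : realizable f -> realizable g -> realizable h ->
  decidable (fun L m v => split1 (e L m) (f L m v) (g L m v) (h L m v)).
Proof.
move=> rf rg rh; apply: decidable_or; first exact: decidable_eqn.
apply: decidable_or; first exact: decidable_eqn.
by apply: decidable_neg; apply: decidable_eqb; apply: re.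
Qed.

Lemma decidable_split2 f g h : realizable f -> realizable g -> realizable h ->
  decidable (fun L m v => split2 (vertices L m) (e L m) (f L m v) (g L m v) (h L m v)).
Proof.
move=> rf rg rh; apply: decidable_or; first exact: decidable_split1.
apply: (@decidable_has (fun L m y v => split1 (e L m) (f L m v) (g L m v) y &&
  (e L m (h L m v) y != e L m (h L m v) (f L m v)))).
have rf' := realizable_drop 1 rf; have rg' := realizable_drop 1 rg.
have rh' := realizable_drop 1 rh; have rx := realizable_var_drop 0.
apply: decidable_and; first exact: (decidable_split1 rf' rg' rx).
by apply: decidable_neg; apply: decidable_eqb; apply: re.
Qed.

Lemma decidable_p4 f1 f2 f3 f4 : realizable f1 -> realizable f2 -> realizable f3 ->
  realizable f4 ->
  decidable (fun L m v => p4 (e L m) (f1 L m v) (f2 L m v) (f3 L m v) (f4 L m v)).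
Proof.
by move=> r1 r2 r3 r4; do !apply: decidable_and; do ?apply: decidable_neg; apply: re.
Qed.

Section Predicate.

Variable P : nat -> (nat -> nat) -> nat -> seq nat -> bool.
Hypothesis rP : decidable (fun L m v => P L m (nth 0 v 0) (behead v)).

Let x0 := realizable_var_drop 0.
Let x1 := realizable_var_drop 1.
Let x2 := realizable_var_drop 2.
Let x3 := realizable_var_drop 3.

Lemma decidable_moduleb :
  decidable (fun L m v => moduleb (vertices L m) (e L m) (fun x => P L m x v)).
Proof.
apply: decidable_neg.
apply: (@decidable_has (fun L m x v => has (fun y => has (fun z =>
  [&& P L m x v, P L m y v, ~~ P L m z v & e L m z x != e L m z y]) _) _)).
apply: (@decidable_has (fun L m y v => has (fun z => [&& P L m (nth 0 v 0) (behead v),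
  P L m y (behead v), ~~ P L m z (behead v) & e L m z (nth 0 v 0) != e L m z y]) _)).
apply: (@decidable_has (fun L m z v => [&& P L m (nth 0 (behead v) 0) (iter 2 behead v),
  P L m (nth 0 v 0) (iter 2 behead v), ~~ P L m z (iter 2 behead v)
  & e L m z (nth 0 (behead v) 0) != e L m z (nth 0 v 0)])).
apply: decidable_and; first exact: (@decidable_let 3 P _ rP x2).
apply: decidable_and; first exact: (@decidable_let 3 P _ rP x1).
apply: decidable_and; first by apply: decidable_neg; exact: (@decidable_let 3 P _ rP x0).
by apply: decidable_neg; apply: decidable_eqb; apply: re.
Qed.

Lemma decidable_cographb :
  decidable (fun L m v => cographb (vertices L m) (e L m) (fun x => P L m x v)).
Proof.
apply: decidable_neg.
apply: (@decidable_has (fun L m a v => has (fun b => has (fun c => has (fun d =>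
  [&& P L m a v, P L m b v, P L m c v, P L m d v & p4 (e L m) a b c d]) _) _) _)).
apply: (@decidable_has (fun L m b v => has (fun c => has (fun d =>
  [&& P L m (nth 0 v 0) (behead v), P L m b (behead v), P L m c (behead v),
      P L m d (behead v) & p4 (e L m) (nth 0 v 0) b c d]) _) _)).
apply: (@decidable_has (fun L m c v => has (fun d =>
  [&& P L m (nth 0 (behead v) 0) (iter 2 behead v), P L m (nth 0 v 0) (iter 2 behead v),
      P L m c (iter 2 behead v), P L m d (iter 2 behead v)
    & p4 (e L m) (nth 0 (behead v) 0) (nth 0 v 0) c d]) _)).
apply: (@decidable_has (fun L m d v =>
  [&& P L m (nth 0 (iter 2 behead v) 0) (iter 3 behead v),
      P L m (nth 0 (behead v) 0) (iter 3 behead v),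
      P L m (nth 0 v 0) (iter 3 behead v), P L m d (iter 3 behead v)
    & p4 (e L m) (nth 0 (iter 2 behead v) 0) (nth 0 (behead v) 0) (nth 0 v 0) d])).
apply: decidable_and; first exact: (@decidable_let 4 P _ rP x3).
apply: decidable_and; first exact: (@decidable_let 4 P _ rP x2).
apply: decidable_and; first exact: (@decidable_let 4 P _ rP x1).
apply: decidable_and; first exact: (@decidable_let 4 P _ rP x0).
exact: decidable_p4.
Qed.

End Predicate.
Lemma realizable_succ f : realizable f -> realizable (fun L m v => (f L m v).+1).
Proof. exact: (realizable_add (realizable_const 1)). Qed.

Lemma decidable_ltn f1 f2 : realizable f1 -> realizable f2 ->
  decidable (fun L m v => f1 L m v < f2 L m v).
Proof. by move=> r1 r2; apply: (decidable_leq (realizable_succ r1) r2). Qed.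

Let x0 := realizable_var_drop 0.
Let x1 := realizable_var_drop 1.

Lemma decidable_twin f g : realizable f -> realizable g ->
  decidable (fun L m v => twin (vertices L m) (e L m) (f L m v) (g L m v)).
Proof.
move=> rf rg; have rf' := realizable_drop 1 rf; have rg' := realizable_drop 1 rg.
have rS := decidable_split2 rg' rf' x0.
apply: decidable_and.
  exact: (@decidable_moduleb (fun L m x v =>
    split2 (vertices L m) (e L m) (g L m v) (f L m v) x) rS).
exact: (@decidable_cographb (fun L m x v =>
  split2 (vertices L m) (e L m) (g L m v) (f L m v) x) rS).
Qed.

Lemma decidable_twin_rule f g : realizable f -> realizable g ->
  decidable (fun L m v => twin_rule (vertices L m) (e L m) (f L m v) (g L m v)).
Proof.
move=> rf rg; have rg' := realizable_drop 1 rg.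
apply: (decidable_ltn (realizable_succ rf)).
apply: (@realizable_count (fun L m u v => twin (vertices L m) (e L m) (g L m v) u)).
exact: decidable_twin.
Qed.

Lemma decidable_core f g h : realizable f -> realizable g -> realizable h ->
  decidable (fun L m v => core (vertices L m) (e L m) (f L m v) (g L m v) (h L m v)).
Proof.
move=> rf rg rh; apply: decidable_and; first exact: decidable_split2.
have rf' := realizable_drop 1 rf; have rg' := realizable_drop 1 rg.
have rh' := realizable_drop 1 rh.
apply: (@decidable_has (fun L m z v =>
  [&& split2 (vertices L m) (e L m) (f L m v) (g L m v) z, ~~ e L m z (g L m v)
    & ~~ e L m z (h L m v)])).
apply: decidable_and; first exact: (decidable_split2 rf' rg' x0).
by apply: decidable_and; apply: decidable_neg; apply: re.
Qed.

Lemma decidable_chain_rule f g : realizable f -> realizable g ->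
  decidable (fun L m v => chain_rule (vertices L m) (e L m) (f L m v) (g L m v)).
Proof.
move=> rf rg; have rf1 := realizable_drop 1 rf; have rg1 := realizable_drop 1 rg.
have rg2 := realizable_drop 2 rg; have rg3 := realizable_drop 3 rg.
apply: (@decidable_has (fun L m u v =>
  [&& moduleb (vertices L m) (e L m) (split2 (vertices L m) (e L m) u (g L m v)),
      (f L m v).+1 < count (split2 (vertices L m) (e L m) u (g L m v)) (vertices L m),
      cographb (vertices L m) (e L m) (core (vertices L m) (e L m) u (g L m v))
    & complete_core (vertices L m) (e L m) u (g L m v)])).
have rS := decidable_split2 x1 rg2 x0.
apply: decidable_and.
  exact: (@decidable_moduleb (fun L m x v =>
    split2 (vertices L m) (e L m) (nth 0 v 0) (g L m (behead v)) x) rS).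
apply: decidable_and.
  apply: (decidable_ltn (realizable_succ rf1)).
  exact: (@realizable_count (fun L m x v =>
    split2 (vertices L m) (e L m) (nth 0 v 0) (g L m (behead v)) x) rS).
apply: decidable_and.
  exact: (@decidable_cographb (fun L m x v =>
    core (vertices L m) (e L m) (nth 0 v 0) (g L m (behead v)) x)
    (decidable_core x1 rg2 x0)).
have x2 := realizable_var_drop 2.
apply: decidable_neg; apply: (@decidable_has (fun L m w v => has (fun w' =>
  [&& core (vertices L m) (e L m) (nth 0 v 0) (g L m (behead v)) w,
      split2 (vertices L m) (e L m) (nth 0 v 0) (g L m (behead v)) w',
      ~~ core (vertices L m) (e L m) (nth 0 v 0) (g L m (behead v)) w' & ~~ e L m w w'])
        _)).
apply: (@decidable_has (fun L m w' v =>
  [&& core (vertices L m) (e L m) (nth 0 (behead v) 0) (g L m (iter 2 behead v)) (nth 0 v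
    0),
      split2 (vertices L m) (e L m) (nth 0 (behead v) 0) (g L m (iter 2 behead v)) w',
      ~~ core (vertices L m) (e L m) (nth 0 (behead v) 0) (g L m (iter 2 behead v)) w'
    & ~~ e L m (nth 0 v 0) w'])).
apply: decidable_and; first exact: (decidable_core x2 rg3 x1).
apply: decidable_and; first exact: (decidable_split2 x2 rg3 x0).
by apply: decidable_and; apply: decidable_neg;
  [apply: (decidable_core x2 rg3 x0) | apply: re].
Qed.

Lemma decidable_edge_rule f g h : realizable f -> realizable g -> realizable h ->
  decidable (fun L m v => edge_rule (vertices L m) (e L m) (f L m v) (g L m v) (h L m v)).
Proof.
move=> rf rg rh; have rf1 := realizable_drop 1 rf.
have rg2 := realizable_drop 2 rg; have rh2 := realizable_drop 2 rh.
apply: (@decidable_has (fun L m z v => f L m v <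
  count (fun p => p4 (e L m) (g L m v) z (h L m v) p) (vertices L m))).
apply: (decidable_ltn rf1).
apply: (@realizable_count (fun L m p v =>
  p4 (e L m) (g L m (behead v)) (nth 0 v 0) (h L m (behead v)) p)).
exact: (decidable_p4 rg2 x1 rh2 x0).
Qed.

End RealizeRules.

Lemma decidable_vertex_rule e f g : decidable_rel e -> realizable f -> realizable g ->
  decidable (fun L m v => vertex_rule (vertices L m) (e L m) (f L m v) (g L m v)).
Proof.
move=> re rf rg; apply: decidable_or; first exact: decidable_twin_rule.
by apply: decidable_or; apply: decidable_chain_rule => //; apply: decidable_compl.
Qed.

Definition mul_upto (L x y : nat) : nat := \sum_(i < L) if i < x then y else 0.

(** The first factor is the number of nonzero terms and must fit in the loop; the second may be
    arbitrarily large. *)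
Lemma mul_uptoE L x y : x <= L -> mul_upto L x y = x * y.
Proof.
move=> xL; rewrite /mul_upto -(big_mkord xpredT (fun i => if i < x then y else 0)).
rewrite (big_cat_nat (n := x)) //= [X in _ + X]big1_seq ?addn0; last first.
  by move=> i /andP[_]; rewrite mem_index_iota => /andP[xi _]; rewrite ltnNge xi.
rewrite (eq_big_nat _ _ (F2 := fun=> y)); last by move=> i /andP[_ ->].
by rewrite sum_nat_const_nat subn0.
Qed.

Lemma realizable_mul f g : realizable f -> realizable g ->
  realizable (fun L m v => mul_upto L (f L m v) (g L m v)).
Proof.
move=> rf rg; apply: (@realizable_sum (fun L m i v => if i < f L m v then g L m v else 0)).
apply: realizable_if; last exact: realizable_const.
  exact: (decidable_ltn (realizable_var_drop 0) (realizable_drop 1 rf)).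
exact: (realizable_drop 1 rg).
Qed.

Definition div_upto (L q d : nat) : nat := find (fun i => q < mul_upto L i.+1 d) (iota 0 L).

Lemma div_uptoE L q d : 0 < d -> q < L -> div_upto L q d = q %/ d.
Proof.
move=> d0 qL; rewrite /div_upto; set P := (X in find X _).
have PE i : i < L -> P i = (q %/ d <= i).
  by move=> iL; rewrite /P mul_uptoE // -(ltnS (q %/ d)) ltn_divLR.
have dL : q %/ d < L by apply: leq_ltn_trans (leq_div q d) qL.
have hP : has P (iota 0 L).
  by apply/hasP; exists (q %/ d); rewrite ?mem_iota // PE.
have FL : find P (iota 0 L) < L by rewrite -[X in _ < X](size_iota 0 L) -has_find.
apply/eqP; rewrite eqn_leq; apply/andP; split.
  rewrite leqNgt; apply/negP => /(before_find 0).
  by rewrite nth_iota // add0n PE // leqnn.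
by have := nth_find 0 hP; rewrite nth_iota // add0n PE.
Qed.

Lemma realizable_div f g : realizable f -> realizable g ->
  realizable (fun L m v => div_upto L (f L m v) (g L m v)).
Proof.
move=> rf rg; apply: (@realizable_find (fun L m i v => f L m v < mul_upto L i.+1 (g L m
  v))).
apply: (decidable_ltn (realizable_drop 1 rf)).
exact: (realizable_mul (realizable_succ (realizable_var_drop 0)) (realizable_drop 1 rg)).
Qed.

Lemma find_iota L (P : pred nat) : find P (iota 0 L) < L -> P (find P (iota 0 L)).
Proof.
move=> FL; have : has P (iota 0 L) by rewrite has_find size_iota.
by move/(nth_find 0); rewrite nth_iota // add0n.
Qed.

Lemma find_iota_leq L (P : pred nat) x : x < L -> P x -> find P (iota 0 L) <= x.
Proof.
move=> xL Px; rewrite leqNgt; apply/negP => /(before_find 0).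
by rewrite nth_iota // add0n Px.
Qed.

(** The edges are those added to the empty graph. The filter on cardinality discards loops, so that
    any relation yields a graph. *)
Definition graph_of_rel (n : nat) (e : rel 'I_n) : graph :=
  @Graph n [set B in added (fun _ _ => false) e | #|B| == 2]
    (fun B HB => eqP (proj2 (andP (etrans (esym (in_set _ B)) HB)))).

Lemma adj_graph_of_rel n (e : rel 'I_n) : symmetric e -> irreflexive e ->
  adj (edges (graph_of_rel e)) =2 e.
Proof.
move=> es ei x y; rewrite /adj /= inE mem_added // andbT cards2.
by have [xy|_] := eqVneq x y; rewrite ?andbT // xy ei.
Qed.

Lemma adj_sym (T : finType) (E : {set {set T}}) : symmetric (adj E).
Proof. by move=> x y; rewrite /adj setUC. Qed.

Lemma adj_irr (G : graph) : irreflexive (adj (edges G)).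
Proof.
by move=> x; rewrite /adj setUid; apply/negbTE/negP => /edgesP; rewrite cards1.
Qed.

Lemma eq_completable (T : finType) (e e' : rel T) k : e =2 e' ->
  completable e k <-> completable e' k.
Proof.
suff H (d d' : rel T) : d =2 d' -> completable d k -> completable d' k.
  by move=> E; split; apply: H.
move=> E [h [hs hi dh ch leF]]; exists h; split=> //; first by move=> x y; rewrite -E;
  apply: dh.
apply: leq_trans leF; apply: subset_leq_card; apply/subsetP => B /imsetP[z].
by rewrite inE -E => zP ->; apply: imset_f; rewrite inE.
Qed.

(** * One reduction round on the table *)

Definition edge_at (L : nat) (m : nat -> nat) : rel nat :=
  fun i j => m (2 + mul_upto L i (m 1) + j) != 0.

Definition first_vertex (L : nat) (m : nat -> nat) : nat :=
  find (fun v => (v < m 1) && vertex_rule (vertices L m) (edge_at L m) (m 0) v) (iota 0 L).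

Definition first_end (L : nat) (m : nat -> nat) : nat :=
  find (fun x => (x < m 1) &&
    has (fun y => edge_rule (vertices L m) (edge_at L m) (m 0) x y) (vertices L m)) (iota
      0 L).

Definition second_end (L : nat) (m : nat -> nat) : nat :=
  find (fun y => (y < m 1) &&
    edge_rule (vertices L m) (edge_at L m) (m 0) (first_end L m) y) (iota 0 L).

(* The cell holding the entry that moves to cell [a] when row and column [v]
   are deleted from the adjacency matrix. *)
Definition source_cell (L : nat) (m : nat -> nat) (v a : nat) : nat :=
  let i := div_upto L (a - 2) (m 1 - 1) in
  let j := a - 2 - mul_upto L i (m 1 - 1) in
  2 + mul_upto L (i + (v <= i)) (m 1) + (j + (v <= j)).

(** Cell 0 holds the parameter, cell 1 the number of vertices, and the matrix starts at cell 2. A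
    failed search returns [L], which is at least [m 1], so the comparisons with [m 1] test whether a
    rule applies. Adding an edge spends one unit of the parameter, hence [0 < m 0]. *)
Definition step (L : nat) (m : nat -> nat) (a : nat) : nat :=
  if m 1 <= m 0 then m a else
  if first_vertex L m < m 1 then
    if a == 0 then m 0 else
    if a == 1 then m 1 - 1 else m (source_cell L m (first_vertex L m) a)
  else if (0 < m 0) && (first_end L m < m 1) then
    if a == 0 then m 0 - 1 else
    if (a == 2 + mul_upto L (first_end L m) (m 1) + second_end L m) ||
       (a == 2 + mul_upto L (second_end L m) (m 1) + first_end L m)
    then 1 else m a
  else m a.

Lemma realizable_cell c : realizable (fun _ m _ => m c).
Proof. exact: (realizable_read (realizable_const c)). Qed.

Lemma decidable_edge_at : decidable_rel edge_at.
Proof.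
move=> f g rf rg; apply: decidable_neg; apply: decidable_eqn; last exact: realizable_const.
apply: realizable_read; apply: realizable_add => //.
apply: (realizable_add (realizable_const 2)).
exact: (realizable_mul rf (realizable_cell 1)).
Qed.

Lemma realizable_first_vertex : realizable (fun L m _ => first_vertex L m).
Proof.
apply: (@realizable_find (fun L m v _ =>
  (v < m 1) && vertex_rule (vertices L m) (edge_at L m) (m 0) v)).
have x0 := realizable_var_drop 0.
apply: decidable_and; first exact: (decidable_ltn x0 (realizable_cell 1)).
exact: (decidable_vertex_rule decidable_edge_at (realizable_cell 0) x0).
Qed.

Lemma realizable_first_end : realizable (fun L m _ => first_end L m).
Proof.
apply: (@realizable_find (fun L m x _ => (x < m 1) &&
  has (fun y => edge_rule (vertices L m) (edge_at L m) (m 0) x y) (vertices L m))).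
have x0 := realizable_var_drop 0; have x1 := realizable_var_drop 1.
apply: decidable_and; first exact: (decidable_ltn x0 (realizable_cell 1)).
apply: (@decidable_has (fun L m y v => edge_rule (vertices L m) (edge_at L m) (m 0) (nth
  0 v 0) y)).
exact: (decidable_edge_rule decidable_edge_at (realizable_cell 0) x1 x0).
Qed.

Lemma realizable_second_end : realizable (fun L m _ => second_end L m).
Proof.
apply: (@realizable_find (fun L m y _ => (y < m 1) &&
  edge_rule (vertices L m) (edge_at L m) (m 0) (first_end L m) y)).
have x0 := realizable_var_drop 0.
apply: decidable_and; first exact: (decidable_ltn x0 (realizable_cell 1)).
exact: (decidable_edge_rule decidable_edge_at (realizable_cell 0) realizable_first_end x0).
Qed.

Lemma realizable_step : realizable (fun L m v => step L m (nth 0 v 0)).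
Proof.
have x0 := realizable_var_drop 0; have n := realizable_cell 1; have k := realizable_cell 0.
have c0 := realizable_const 0; have c1 := realizable_const 1; have c2 := realizable_const 2.
have v := realizable_first_vertex; have x := realizable_first_end;
  have y := realizable_second_end.
have n1 := realizable_sub n c1; have a2 := realizable_sub x0 c2.
have i := realizable_div a2 n1; have j := realizable_sub a2 (realizable_mul i n1).
have i' := realizable_add i (decidable_leq v i).
have j' := realizable_add j (decidable_leq v j).
have ma := realizable_read x0.
apply: (realizable_if (decidable_leq n k) ma).
apply: (realizable_if (decidable_ltn v n)).
  apply: (realizable_if (decidable_eqn x0 c0) k).
  apply: (realizable_if (decidable_eqn x0 c1) n1).
  exact: (realizable_read (realizable_add (realizable_add c2 (realizable_mul i' n)) j')).
apply: (realizable_if (decidable_and (decidable_ltn c0 k) (decidable_ltn x n)));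
  last exact: ma.
apply: (realizable_if (decidable_eqn x0 c0) (realizable_sub k c1)).
have xy := realizable_add (realizable_add c2 (realizable_mul x n)) y.
have yx := realizable_add (realizable_add c2 (realizable_mul y n)) x.
exact: (realizable_if (decidable_or (decidable_eqn x0 xy) (decidable_eqn x0 yx)) c1 ma).
Qed.

Definition truncate (F : nat -> (nat -> nat) -> nat -> nat) (L : nat) (m : nat -> nat)
    (a : nat) : nat := if a < L then F L m a else 0.

Lemma transformer_step : transformer (truncate step).
Proof. exact: (transformer_update realizable_step). Qed.

Definition encodes (m : nat -> nat) (G : graph) (k : nat) : Prop :=
  [/\ m 0 = k, m 1 = nvert G & forall i j : 'I_(nvert G),
    m (2 + i * nvert G + j) = adj (edges G) i j].

Definition irreducible (G : graph) (k : nat) : Prop := nvert G <= k \/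
  (forall v, ~~ vertex_rule (enum 'I_(nvert G)) (adj (edges G)) k v) /\
  (0 < k -> forall x y, ~~ edge_rule (enum 'I_(nvert G)) (adj (edges G)) k x y).

Section StepSpec.

Variables (L : nat) (m : nat -> nat) (G : graph) (k : nat).
Hypotheses (enc : encodes m G k) (bigL : (nvert G + 5) * (nvert G + 5) <= L).

Let n := nvert G.
Let e := adj (edges G).

Lemma cell_in_table i j : i < n -> j < n -> 2 + i * n + j < L.
Proof. by move=> ilt jlt; apply: leq_trans bigL; rewrite -/n; nia. Qed.

Lemma nvert_in_table : n <= L.
Proof. by apply: leq_trans bigL; rewrite -/n; nia. Qed.

Lemma verticesE : vertices L m = map val (enum 'I_n).
Proof.
have [_ mn _] := enc; rewrite val_enum_ord /vertices mn -/n.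
rewrite -{1}(subnKC nvert_in_table) iotaD filter_cat.
rewrite (_ : [seq i <- iota 0 n | _] = iota 0 n).
  rewrite (_ : [seq i <- iota _ _ | _] = [::]) ?cats0 //.
  apply/eqP; rewrite -(negbK (_ == _)) -has_filter; apply/hasP => -[i].
  by rewrite mem_iota add0n => /andP[ni _] /=; rewrite ltnNge ni.
by apply/all_filterP/allP => i; rewrite mem_iota add0n => /andP[].
Qed.

Lemma edge_atE (i j : 'I_n) : edge_at L m i j = e i j.
Proof.
have [_ mn me] := enc; rewrite /edge_at mn mul_uptoE; first by rewrite me /e; case: adj.
by apply: ltnW; apply: leq_trans (ltn_ord i) nvert_in_table.
Qed.

Lemma vertex_ruleE (v : 'I_n) :
  vertex_rule (vertices L m) (edge_at L m) (m 0) v = vertex_rule (enum 'I_n) e k v.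
Proof.
have [m0 _ _] := enc; rewrite verticesE m0.
exact: (vertex_rule_map _ _ _ val_inj edge_atE).
Qed.

Lemma edge_ruleE (x y : 'I_n) :
  edge_rule (vertices L m) (edge_at L m) (m 0) x y = edge_rule (enum 'I_n) e k x y.
Proof.
have [m0 _ _] := enc; rewrite verticesE m0.
exact: (edge_rule_map _ edge_atE).
Qed.

(** The decrease of the sum bounds the number of rounds; the two separate inequalities keep the
    table large enough and the final bounds valid for the original [k]. *)
Definition progress (F : nat -> nat) : Prop := exists (G' : graph) (k' : nat),
  [/\ encodes F G' k', completable e k <-> completable (adj (edges G')) k',
      nvert G' <= n, k' <= k & nvert G' + k' < n + k].

Lemma encodes_same F : (forall a, a < L -> F a = m a) -> encodes F G k.
Proof.
move=> FE; have [m0 mn me] := enc.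
have L2 : 1 < L by apply: leq_trans bigL; nia.
split; rewrite ?FE //; [exact: ltnW | move=> i j; rewrite FE //].
exact: cell_in_table.
Qed.

Lemma first_vertex_rule (vn : first_vertex L m < n) :
  vertex_rule (enum 'I_n) e k (Ordinal vn).
Proof.
have /andP[_ rule] := find_iota (leq_trans vn nvert_in_table).
by rewrite -vertex_ruleE.
Qed.

Lemma first_end_rule (xn : first_end L m < n) : exists yn : second_end L m < n,
  edge_rule (enum 'I_n) e k (Ordinal xn) (Ordinal yn).
Proof.
have [_ mn _] := enc.
have /andP[_ hx] := find_iota (leq_trans xn nvert_in_table).
case/hasP: hx => y' y'V rule; move: y'V; rewrite verticesE => /mapP[y _ yE].
rewrite yE in rule; have yL : second_end L m <= y.
  apply: find_iota_leq; first by apply: leq_trans (ltn_ord y) nvert_in_table.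
  by rewrite mn ltn_ord.
have yn : second_end L m < n by apply: leq_ltn_trans yL (ltn_ord y).
have /andP[_ {}rule] := find_iota (leq_trans yn nvert_in_table).
by exists yn; rewrite -edge_ruleE.
Qed.

Lemma step_delete : k < n -> first_vertex L m < n -> progress (truncate step L m).
Proof.
move=> ltkn vn; have [m0 mn me] := enc.
have rule := first_vertex_rule vn; set w : 'I_n := Ordinal vn in rule.
pose e' : rel 'I_n.-1 := fun i j => e (lift w i) (lift w j).
have es : symmetric e by apply: adj_sym.
have ei : irreflexive e by apply: adj_irr.
have e's : symmetric e' by move=> i j; apply: es.
have e'i : irreflexive e' by move=> i; apply: ei.
have L2 : 1 < L by apply: leq_trans bigL; nia.
exists (graph_of_rel e'), k; split=> //.
- have mnk : m 1 <= m 0 = false by rewrite mn m0 leqNgt ltkn.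
  have vn' : first_vertex L m < m 1 by rewrite mn.
  split; rewrite /truncate /step mnk vn' ?(ltnW L2) ?L2 //=; first by rewrite mn subn1.
  move=> i j; rewrite adj_graph_of_rel //.
  have [iw jw] := (ltn_ord (lift w i), ltn_ord (lift w j)).
  have n1 : 0 < n.-1 by apply: leq_ltn_trans (ltn_ord i).
  have aL : 2 + i * n.-1 + j < L.
    apply: leq_ltn_trans (cell_in_table iw jw); rewrite /= /bump.
    have : n.-1 <= n by apply: leq_pred.
    nia.
  have aE : 2 + i * n.-1 + j - 2 = i * n.-1 + j by rewrite -addnA addKn.
  rewrite aL /source_cell mn subn1 aE -/n.
  have qL : i * n.-1 + j < L by apply: leq_ltn_trans aL; rewrite -addnA leq_addl.
  rewrite div_uptoE // divnMDl // (divn_small (ltn_ord j)) addn0.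
  have leL (z : nat) : z <= n -> z <= L by move=> zn; apply: leq_trans zn nvert_in_table.
  have iL : i <= L by apply: leL; apply: leq_trans (ltnW (ltn_ord i)) (leq_pred n).
  have bumpE (t : 'I_n.-1) : t + (first_vertex L m <= t) = lift w t.
    by rewrite /= /bump addnC.
  rewrite (mul_uptoE _ iL) addKn !bumpE mul_uptoE; last by apply: leL; apply: ltnW iw.
  by rewrite me.
- apply: (iff_trans _ (iff_sym (eq_completable k (adj_graph_of_rel e's e'i)))).
  have onto x : x != w -> exists a, x = lift w a.
    by rewrite eq_sym => /unlift_some[a -> _]; exists a.
  have neq a : lift w a != w by rewrite eq_sym neq_lift.
  split; first by apply: completable_restrict => //; apply: lift_inj.
  exact: (vertex_rule_sound (@lift_inj _ w) onto es ei rule).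
- exact: leq_pred.
- by rewrite /= -/n ltn_add2r prednK //; apply: leq_ltn_trans ltkn.
Qed.

Lemma step_add : 0 < k -> k < n -> ~~ (first_vertex L m < n) -> first_end L m < n ->
  progress (truncate step L m).
Proof.
move=> k0 ltkn vn xn; have [m0 mn me] := enc.
have [yn rule] := first_end_rule xn.
set x : 'I_n := Ordinal xn in rule; set z : 'I_n := Ordinal yn in rule.
have es : symmetric e by apply: adj_sym.
have ei : irreflexive e by apply: adj_irr.
have e's := add_edge_sym x z es; have e'i := add_edge_irr ei rule.
have L2 : 1 < L by apply: leq_trans bigL; nia.
exists (graph_of_rel (add_edge e x z)), k.-1; split=> //.
- have mnk : m 1 <= m 0 = false by rewrite mn m0 leqNgt ltkn.
  have vn' : first_vertex L m < m 1 = false by rewrite mn (negbTE vn).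
  have xn' : (0 < m 0) && (first_end L m < m 1) by rewrite m0 mn k0 xn.
  have mulE (t : nat) : t < n -> mul_upto L t (m 1) = t * n.
    by move=> tn; rewrite mn mul_uptoE // ltnW // (leq_trans tn nvert_in_table).
  split; rewrite /truncate /step mnk vn' xn' ?(ltnW L2) ?L2 //=.
  + by rewrite m0 subn1.
  move=> i j; rewrite adj_graph_of_rel // cell_in_table // !mulE //.
  have cellE (a b c d : nat) : b < n -> d < n ->
      (2 + a * n + b == 2 + c * n + d) = (a == c) && (b == d).
    move=> bn dn; rewrite -!addnA eqn_add2l; apply/eqP/andP => [E|[/eqP-> /eqP->]//].
    have n0 : 0 < n by apply: leq_ltn_trans bn.
    have : (a * n + b) %/ n = (c * n + d) %/ n by rewrite E.
    have : (a * n + b) %% n = (c * n + d) %% n by rewrite E.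
    by rewrite !modnMDl !divnMDl // !modn_small // !divn_small // !addn0 => -> ->.
  rewrite !cellE //= /add_edge.
  rewrite -[first_end L m]/(val x) -[second_end L m]/(val z) !(inj_eq val_inj).
  by case: ifP => H; rewrite ?orbT ?orbF // me.
- apply: (iff_trans _ (iff_sym (eq_completable _ (adj_graph_of_rel e's e'i)))).
  exact: edge_rule_sound.
- exact: leq_pred.
- by rewrite /= -/n ltn_add2l prednK.
Qed.

Lemma step_irreducible : ~~ (first_vertex L m < n) -> ~~ ((0 < k) && (first_end L m < n)) ->
  irreducible G k.
Proof.
move=> vn xn; have [m0 mn _] := enc; right; split=> [v|k0 x y].
  apply: contra vn => rule; apply: leq_ltn_trans (ltn_ord v).
  apply: find_iota_leq; first by apply: leq_trans (ltn_ord v) nvert_in_table.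
  by rewrite mn ltn_ord vertex_ruleE.
apply: contra xn => rule; rewrite k0 /=; apply: leq_ltn_trans (ltn_ord x).
apply: find_iota_leq; first by apply: leq_trans (ltn_ord x) nvert_in_table.
rewrite mn ltn_ord; apply/hasP; exists (val y); last by rewrite edge_ruleE.
by rewrite verticesE map_f // mem_enum.
Qed.

Lemma step_stable : irreducible G k -> encodes (truncate step L m) G k.
Proof.
have [m0 mn _] := enc => irr; apply: encodes_same => a aL; rewrite /truncate aL /step mn m0.
have [//|kn] := leqP (nvert G) k; case: irr => [|[novertex noedge]];
  first by rewrite leqNgt kn.
rewrite ifN; last first.
  by apply/negP => vn; have := first_vertex_rule vn; apply/negP/novertex.
rewrite ifN //; apply/negP => /andP[k0 xn]; have [yn] := first_end_rule xn.
by apply/negP; apply: noedge.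
Qed.

Lemma step_progress : irreducible G k \/ k < n /\ progress (truncate step L m).
Proof.
have [nk|kn] := leqP n k; first by left; left.
have [vn|vn] := boolP (first_vertex L m < n); first by right; split=> //;
  apply: step_delete.
have [/andP[k0 xn]|xn] := boolP ((0 < k) && (first_end L m < n)).
  by right; split=> //; apply: step_add.
by left; apply: step_irreducible.
Qed.

End StepSpec.

(** * The kernel *)

Definition equivalent (G : graph) (k : nat) (G' : graph) (k' : nat) : Prop :=
  completable (adj (edges G)) k <-> completable (adj (edges G')) k'.

(** The number of rounds does not depend on when reduction ends, as a reduced instance is left
    unchanged. The first alternative also covers [nvert G <= k], where [k] may exceed any number of
    rounds. *)
Lemma iter_step_spec L j m G k : encodes m G k -> (nvert G + 5) * (nvert G + 5) <= L ->
  irreducible G k \/ nvert G + k <= j ->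
  exists (G' : graph) (k' : nat), [/\ encodes (iter j (truncate step L) m) G' k',
    equivalent G k G' k', k' <= k, irreducible G' k' & nvert G' <= nvert G].
Proof.
elim: j m G k => [|j IH] m G k enc bigL Hj.
  exists G, k; split=> //; case: Hj => // nk; left.
  by move: nk; rewrite leqn0 addn_eq0 => /andP[/eqP-> _].
rewrite iterSr; have [irr|[kn [G' [k' [enc' eqv le1 le2 lt]]]]] := step_progress enc bigL.
  by apply: IH; [apply: step_stable | | left].
case: Hj => [irr|Hj].
  by apply: IH; [apply: step_stable | | left].
have [| |G2 [k2 [h1 h2 h3 h4 h5]]] := IH _ _ _ enc'.
- by apply: leq_trans bigL; apply: leq_mul; rewrite leq_add2r.
- by right; rewrite -ltnS; apply: leq_trans Hj.
exists G2, k2; split=> //; first exact: iff_trans eqv h2.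
  exact: leq_trans h3 le2.
exact: leq_trans h5 le1.
Qed.

(* The table of a negative instance: the path on four vertices, with [k = 0]. *)
Definition p4_table : seq nat := [:: 0; 4; 0; 1; 0; 0; 1; 0; 1; 0; 0; 1; 0; 1; 0; 0; 1; 0].

Definition size_bound (L : nat) (m : nat -> nat) : nat :=
  mul_upto L (m 0).+1 (mul_upto L (m 0).+1 (mul_upto L (m 0).+1 13)).

(** [m 1 <= m 0] is tested first: otherwise [m 0 < m 1] ensures [(m 0).+1 <= L], under which
    [mul_upto] computes the cubic bound correctly. *)
Definition finish (L : nat) (m : nat -> nat) (a : nat) : nat :=
  if m 1 <= m 0 then m a else
  if size_bound L m < m 1 then nth 0 p4_table a else m a.

Lemma realizable_nth s f : realizable f -> realizable (fun L m v => nth 0 s (f L m v)).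
Proof.
move=> rf; elim: s f rf => [|x s IH] f rf.
  by apply: realizable_ext (realizable_const 0) => L m v; rewrite nth_nil.
apply: (@realizable_ext (fun L m v => if f L m v == 0 then x else nth 0 s (f L m v - 1))).
  by move=> L m v; case: (f L m v) => //= i; rewrite subn1.
have c0 := realizable_const 0; have c1 := realizable_const 1.
apply: (realizable_if (decidable_eqn rf c0) (realizable_const x)).
exact: (IH _ (realizable_sub rf c1)).
Qed.

Lemma realizable_finish : realizable (fun L m v => finish L m (nth 0 v 0)).
Proof.
have n := realizable_cell 1; have k := realizable_cell 0; have k1 := realizable_succ k.
have x0 := realizable_var_drop 0; have mx := realizable_read x0.
apply: (realizable_if (decidable_leq n k) mx).
have b := realizable_mul k1 (realizable_mul k1 (realizable_mul k1 (realizable_const 13))).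
exact: (realizable_if (decidable_ltn b n) (realizable_nth p4_table x0) mx).
Qed.

Lemma P4_sym : symmetric P4.
Proof. by move=> i j; rewrite /P4 orbC. Qed.

Lemma P4_irr : irreflexive P4.
Proof. by move=> i; rewrite /P4 gtn_eqF. Qed.

Lemma P4_not_completable : ~ completable (adj (edges (graph_of_rel P4))) 0.
Proof.
move/(eq_completable 0 (adj_graph_of_rel P4_sym P4_irr)) => [h [hs hi eh ch]].
rewrite leqn0 cards_eq0 => /eqP F0.
have hE : h =2 P4.
  move=> i j; apply/idP/idP; last exact: eh.
  move=> hij; apply: contraT => Pij; have := in_set0 [set i; j].
  by rewrite -F0 (mem_added _ _ P4_sym hs) hij Pij.
pose g i : 'I_4 := inord i.
have := ch (g 0) (g 1) (g 2) (g 3).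
by rewrite /p4 !hE /P4 !inordK // !inE => /(_ isT isT isT isT).
Qed.

Lemma irreducible_bound G k : irreducible G k -> completable (adj (edges G)) k ->
  nvert G <= 13 * k.+1 ^ 3.
Proof.
case=> [nk _|[novertex noedge] [h [hs hi eh ch leF]]].
  by apply: leq_trans nk _; rewrite !expnS; nia.
have := reduced_bound (@adj_sym _ _) (@adj_irr G) hs hi eh ch leF novertex noedge.
by rewrite card_ord.
Qed.

Lemma finish_spec L m G k : encodes m G k -> (nvert G + 5) * (nvert G + 5) <= L ->
  irreducible G k ->
  exists (G' : graph) (k' : nat), [/\ encodes (truncate finish L m) G' k',
    equivalent G k G' k', k' <= k, nvert G' <= 13 * k.+1 ^ 3 & nvert G' <= nvert G].
Proof.
move=> enc bigL irr; have [m0 mn me] := enc.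
have L25 : 25 <= L by apply: leq_trans bigL; nia.
have bound4 : 4 <= 13 * k.+1 ^ 3 by rewrite !expnS; nia.
have [nk|kn] := leqP (nvert G) k.
  exists G, k; split=> //; last by apply: leq_trans nk _; rewrite !expnS; nia.
  by apply: (encodes_same enc bigL) => a aL; rewrite /truncate aL /finish mn m0 nk.
have k1L : k.+1 <= L by apply: leq_trans bigL; nia.
have bE : size_bound L m = 13 * k.+1 ^ 3.
  by rewrite /size_bound m0 !mul_uptoE // !expnS expn0 muln1 [RHS]mulnC !mulnA.
have [le|lt] := leqP (nvert G) (13 * k.+1 ^ 3).
  exists G, k; split=> //; apply: (encodes_same enc bigL) => a aL.
  by rewrite /truncate aL /finish mn m0 leqNgt kn /= bE ltnNge le.
exists (graph_of_rel P4), 0; split=> //; last exact: leq_trans bound4 (ltnW lt).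
- have E a : a < 18 -> truncate finish L m a = nth 0 p4_table a.
    move=> a18; rewrite /truncate (leq_trans a18) ?(leq_trans _ L25) // /finish.
    by rewrite mn m0 leqNgt kn /= bE lt.
  split; rewrite ?E // => i j; rewrite adj_graph_of_rel //; [|exact: P4_sym|exact: P4_irr].
  by case: i => [[|[|[|[|]]]]] //= ?; case: j => [[|[|[|[|]]]]] //= ?; rewrite E.
- split=> [cG|/P4_not_completable] //.
  by move: lt; rewrite ltnNge (irreducible_bound irr cG).
Qed.

Lemma nth_allpairs (S T R : Type) (f : S -> T -> R) s t x y z i j :
  i < size s -> j < size t ->
  nth z [seq f a b | a <- s, b <- t] (i * size t + j) = f (nth x s i) (nth y t j).
Proof.
elim: s i => [|a s IH] [|i] //= ilt jlt; rewrite nth_cat size_map.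
  by rewrite mul0n jlt (nth_map y).
by rewrite mulSn -addnA ltnNge leq_addr /= addKn IH.
Qed.

Lemma size_enc_graph G k :
  size (enc_instance enc_graph (G, k)) = 2 + nvert G * nvert G.
Proof. by rewrite /= size_allpairs size_enum_ord. Qed.

Lemma nth_enc_graph G k (i j : 'I_(nvert G)) :
  nth 0 (enc_instance enc_graph (G, k)) (2 + i * nvert G + j) = adj (edges G) i j.
Proof.
have := @nth_allpairs _ _ _ (fun i j => nat_of_bool (adj (edges G) i j))
  (enum 'I_(nvert G)) (enum 'I_(nvert G)) i j 0 i j.
by rewrite size_enum_ord !nth_ord_enum -addnA; apply.
Qed.

Lemma encodes_enc G k : encodes (nth 0 (enc_instance enc_graph (G, k))) G k.
Proof. by split=> // i j; apply: nth_enc_graph. Qed.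

Lemma encodes_nth m G k a : encodes m G k -> a < size (enc_instance enc_graph (G, k)) ->
  m a = nth 0 (enc_instance enc_graph (G, k)) a.
Proof.
case=> m0 mn me; rewrite size_enc_graph; case: a => [|[|a]] // an.
have {}an : a < nvert G * nvert G by [].
have n0 : 0 < nvert G by case: (nvert G) an.
have iP : a %/ nvert G < nvert G by rewrite ltn_divLR.
have jP : a %% nvert G < nvert G by rewrite ltn_mod.
have := me (Ordinal iP) (Ordinal jP).
rewrite -(nth_enc_graph k) -addnA /= -divn_eq; exact.
Qed.

(* The graph read off a table, symmetrized so that it is always a graph. *)
Definition decode (m : nat -> nat) : graph * nat :=
  (graph_of_rel (fun i j : 'I_(m 1) => (i != j) &&
     ((m (2 + i * m 1 + j) != 0) || (m (2 + j * m 1 + i) != 0))), m 0).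

(** The rounds are only known to encode some graph; [decode] makes the result a function of the
    table. The graph is destructed because the type of its edges depends on [nvert G], which has to
    become [m 1]. *)
Lemma decode_spec m G k : encodes m G k ->
  encodes m (decode m).1 (decode m).2 /\ equivalent G k (decode m).1 (decode m).2.
Proof.
case=> m0 m1; case: G m1 => n E HE /= m1; move: E HE; rewrite -m1 => E HE me.
have as_ := adj_sym E; have ai : irreflexive (adj E) := @adj_irr (Graph HE).
set r := fun i j : 'I_(m 1) => _.
have rE : r =2 adj E.
  move=> i j; rewrite /r !me (as_ j i) orbb; case: eqVneq => [->|_]; first by rewrite ai.
  by case: adj.
have rs : symmetric r by move=> i j; rewrite !rE.
have ri : irreflexive r by move=> i; rewrite !rE.
split.
  by split=> //= i j; rewrite adj_graph_of_rel // rE me.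
rewrite /equivalent /= -m0; apply: eq_completable => i j /=.
by rewrite adj_graph_of_rel // rE.
Qed.

(** Independent of [k] and fixed for the whole run: large enough for the input of length
    [2 + n * n], for [n + k] rounds when [k < n], and for the 18 cells of [p4_table]. *)
Definition table_size (n : nat) : nat := (n + 5) * (n + 5).

Definition kernel_table (L : nat) (m : nat -> nat) : nat -> nat :=
  truncate finish L (iter L (truncate step L) m).

Definition kernel (Gk : graph * nat) : graph * nat :=
  decode (kernel_table (table_size (nvert Gk.1)) (nth 0 (enc_instance enc_graph Gk))).

Lemma kernel_spec G k (m := nth 0 (enc_instance enc_graph (G, k))) :
  [/\ encodes (kernel_table (table_size (nvert G)) m) (kernel (G, k)).1 (kernel (G, k)).2,
    equivalent G k (kernel (G, k)).1 (kernel (G, k)).2,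
    (kernel (G, k)).2 <= k, nvert (kernel (G, k)).1 <= 13 * k.+1 ^ 3
  & nvert (kernel (G, k)).1 <= nvert G].
Proof.
set L := table_size (nvert G); have bigL : (nvert G + 5) * (nvert G + 5) <= L by [].
have H1 : irreducible G k \/ nvert G + k <= L.
  have [nk|kn] := leqP (nvert G) k; first by left; left.
  by right; apply: leq_trans bigL; nia.
have [G1 [k1 [enc1 eq1 le1 irr nv1]]] := iter_step_spec (encodes_enc G k) bigL H1.
have bigL1 : (nvert G1 + 5) * (nvert G1 + 5) <= L.
  by apply: leq_trans bigL; apply: leq_mul; rewrite leq_add2r.
have [G2 [k2 [enc2 eq2 le2 bound nv2]]] := finish_spec enc1 bigL1 irr.
have [enc3 eq3] := decode_spec enc2.
have [m0 m1 _] := enc2; split=> //.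
- exact: iff_trans eq1 (iff_trans eq2 eq3).
- by rewrite [(kernel (G, k)).2]m0; apply: leq_trans le2 le1.
- rewrite [nvert _]m1; apply: leq_trans bound _.
  by rewrite leq_mul2l leq_exp2r // ltnS le1 orbT.
- by rewrite [nvert _]m1; apply: leq_trans nv2 nv1.
Qed.

Lemma transformer_kernel_table : transformer kernel_table.
Proof.
apply: (@transformer_comp (fun L m => iter L (truncate step L) m) (truncate finish)).
  exact: (transformer_iter transformer_step).
exact: (transformer_update realizable_finish).
Qed.

Definition prelude : cmd :=
  Seq (Assign 1 (Add (Defs.Mem (Const 1)) (Const 5)))
    (While (Defs.Sub (Reg 1) (Reg 2))
      (Seq (Assign 0 (Add (Reg 0) (Reg 1))) (Assign 2 (Add (Reg 2) (Const 1))))).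

Lemma prelude_exec w : exists t s, [/\ exec prelude (input w) t s,
  regs s 0 = table_size (nth 0 w 1), Defs.mem s = nth 0 w & t <= 3 * nth 0 w 1 + 17].
Proof.
set N := nth 0 w 1 + 5.
pose Inv i s := [/\ regs s 0 = i * N, regs s 1 = N, regs s 2 = i & Defs.mem s = nth 0 w].
pose s0 := State (update (fun=> 0) 1 N) (nth 0 w).
pose body := Seq (Assign 0 (Add (Reg 0) (Reg 1))) (Assign 2 (Add (Reg 2) (Const 1))).
have [| | |t [s [ex [h0 _ _ h3] le]]] :=
    @while_loop (Defs.Sub (Reg 1) (Reg 2)) body Inv N 2 _ _ s0.
- by move=> i s [_ h1 h2 _] /=; rewrite h1 h2.
- move=> i s iN [h0 h1 h2 h3]; exists 2; eexists; split=> //.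
    by apply: (@ExecSeq _ _ _ _ _ 1 1); apply: ExecAssign.
  by split=> //=; rewrite !updateE /= ?updateE /= ?h0 ?h1 ?h2 ?addn1 // mulSnr.
- by split=> //=; rewrite updateE.
exists (1 + t), s; split=> //.
- apply: (@ExecSeq _ _ _ _ _ 1 t) ex.
  exact: (ExecAssign (input w) 1 (Add (Defs.Mem (Const 1)) (Const 5))).
- by rewrite /N in le *; lia.
Qed.

Lemma size_leq_bitsize w : size w <= bitsize w.
Proof. by rewrite -sum1_size; apply: leq_sum. Qed.

Lemma polytime_kernel : polytime (enc_instance enc_graph) (enc_instance enc_graph) kernel.
Proof.
have [p [D H]] := transformer_kernel_table (d := 1) isT.
(* The bit size is at least [2 + n * n], and 40 times it bounds both [(n + 5)^2 + 2], the base of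
   the main time bound, and [3n + 17], the cost of the prelude. *)
exists (Seq prelude p), (40 + 40 ^ D), D.+1 => -[G k].
set w := enc_instance enc_graph (G, k); set n := nvert G.
have sw : size w = 2 + n * n by apply: size_enc_graph.
have [t1 [s1 [ex1 r1 m1 le1]]] := prelude_exec w.
rewrite [nth 0 w 1](_ : _ = n) // in r1 le1.
have R : rep (table_size n) (nth 0 w) s1.
  split=> // [a _|a La]; first by rewrite m1.
  by apply: nth_default; apply: leq_trans La; rewrite sw /table_size; nia.
have [t2 [s2 [ex2 R2 _ le2]]] := H _ _ _ R.
exists (t1 + t2), s2; split; first exact: ExecSeq ex1 ex2.
  have [enc _ _ _ nv] := kernel_spec G k; case: R2 => _ R2 R3.
  move=> a; rewrite [kernel (G, k)]surjective_pairing => alt.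
  rewrite -(encodes_nth enc alt); apply: R2; apply: leq_trans alt _.
  by rewrite size_enc_graph /table_size; nia.
have bw : 2 + n * n <= bitsize w by rewrite -sw size_leq_bitsize.
set b := bitsize w in bw *.
have b0 : 0 < b by apply: leq_trans bw.
have tab : (table_size n).+2 <= 40 * b by rewrite /table_size; nia.
have le3 : t2 <= 40 ^ D * b ^ D.+1.
  apply: leq_trans le2 _; apply: (@leq_trans ((40 * b) ^ D)).
    by case: (D) => // D'; rewrite leq_exp2r.
  by rewrite expnMn leq_mul2l leq_pexp2l // orbT.
have le4 : t1 <= 40 * b ^ D.+1.
  apply: leq_trans le1 _; apply: (@leq_trans (40 * b)); first by nia.
  by rewrite leq_mul2l -{1}[b]expn1 leq_pexp2l.
by rewrite mulnDl -addnA; apply: leq_add le4 (leq_trans le3 (leq_addr _ _)).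
Qed.

Lemma bitsize_enc_graph G : bitsize (enc_graph G) <= (nvert G).+1 * (nvert G).+1.
Proof.
rewrite /bitsize big_cons.
have le1 : (trunc_log 2 (nvert G)).+1 <= (nvert G).+1.
  by rewrite ltnS; case: (nvert G) => // n; apply: ltnW;
    apply: leq_trans (ltn_expl _ _) (trunc_logP _ _).
set s := [seq _ | i <- _, j <- _].
have -> : \sum_(x <- s) (trunc_log 2 x).+1 = size s.
  rewrite -sum1_size; apply: eq_big_seq => x /allpairsP[[i j] [_ _ ->]] /=.
  by case: adj.
rewrite size_allpairs size_enum_ord; nia.
Qed.

Definition power_program : cmd :=
  Seq (Assign 0 (Add (Const 8) (Add (Defs.Mem (Const 0)) (Add (Defs.Mem (Const 0))
    (Add (Defs.Mem (Const 0)) (Add (Defs.Mem (Const 0)) (Add (Defs.Mem (Const 0))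
      (Defs.Mem (Const 0)))))))))
  (Seq (Assign 1 (Const 1))
  (Seq (While (Defs.Sub (Reg 0) (Reg 2))
    (Seq (Assign 1 (Add (Reg 1) (Reg 1))) (Assign 2 (Add (Reg 2) (Const 1)))))
  (Store (Const 0) (Reg 1)))).

(** This is the size bound [h]: [13 (k + 1)^3 + 1 <= 2^4 * (2^k)^3], and squaring for the matrix
    gives the exponent [8 + 6k]. A power of two is obtained by repeated doubling, without
    multiplication. *)
Lemma computable_power : computable (fun x => 2 ^ (8 + 6 * x)).
Proof.
exists power_program => x.
pose N := 8 + (x + (x + (x + (x + (x + x))))).
pose Inv i s := [/\ regs s 0 = N, regs s 1 = 2 ^ i & regs s 2 = i].
pose body := Seq (Assign 1 (Add (Reg 1) (Reg 1))) (Assign 2 (Add (Reg 2) (Const 1))).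
pose s0 := State (update (update (fun=> 0) 0 N) 1 1) (nth 0 [:: x]).
have [| | |t [s [ex [h0 h1 h2] _]]] :=
    @while_loop (Defs.Sub (Reg 0) (Reg 2)) body Inv N 2 _ _ s0.
- by move=> i s [h0 _ h2] /=; rewrite h0 h2.
- move=> i s iN [h0 h1 h2]; exists 2; eexists; split=> //.
    by apply: (@ExecSeq _ _ _ _ _ 1 1); apply: ExecAssign.
  by split=> //=; rewrite !updateE /= ?updateE /= ?h0 ?h1 ?h2 ?addn1 // expnS mul2n addnn.
- by split=> //=.
exists (1 + (1 + (t + 1))); eexists; split.
  apply: ExecSeq; first exact: ExecAssign.
  apply: ExecSeq; first exact: ExecAssign.
  by apply: ExecSeq; [exact: ex | apply: ExecStore].
move=> [|//] _ /=; rewrite updateE /= h1; congr (2 ^ _); rewrite /N; lia.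
Qed.

Theorem corollary3p11 :
  exists K : graph * nat -> graph * nat,
    cubic_vertex_kernel cograph_completion K.
Proof.
exists kernel; split; last first.
  (* For [k >= 1], [k + 1 <= 2k], and [104 = 13 * 2^3]. *)
  exists 104, 1 => G k k1; have [_ _ _ le _] := kernel_spec G k.
  apply: leq_trans le _; rewrite -[104]/(13 * 2 ^ 3) -mulnA -expnMn leq_mul2l.
  by rewrite leq_exp2r //; lia.
split; first exact: polytime_kernel.
  move=> G k; have [_ eqv _ _ _] := kernel_spec G k.
  apply: iff_trans (cograph_completion_completable G k) _.
  exact: iff_trans eqv (iff_sym (cograph_completion_completable _ _)).
exists (fun k => 2 ^ (8 + 6 * k)); first exact: computable_power.
move=> G k; have [_ _ le_k le_n _] := kernel_spec G k; split; last first.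
  apply: leq_trans le_k _; apply: leq_trans (ltnW (ltn_expl k (isT : 1 < 2))) _.
  by rewrite leq_pexp2l //; lia.
apply: leq_trans (bitsize_enc_graph _) _.
have lt_n : (nvert (kernel (G, k)).1).+1 <= 2 ^ (4 + 3 * k).
  apply: (@leq_trans (2 ^ 4 * k.+1 ^ 3)).
    apply: (@leq_trans (13 * k.+1 ^ 3).+1) => //.
    have : 0 < k.+1 ^ 3 by rewrite expn_gt0.
    by move: (k.+1 ^ 3) => c c0; lia.
  by rewrite expnD leq_mul2l /= mulnC expnM leq_exp2r // ltn_expl.
by apply: leq_trans (leq_mul lt_n lt_n) _; rewrite -expnD leq_pexp2l //; lia.
Qed.
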